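(* Let $k\geq 2$ be an integer and let $M_k=[z^k-w^k]\subset H^2(\mathbb D^2)$. Then $$\Sigma_0(M_k)=\frac{\pi^2}{6},\qquad \Sigma_j(M_k)=\Sigma_{\lceil j/k\rceil}([z-w])\quad\text{for every integer } j\geq 1.$$
   Context: $H^2(\mathbb D^2)$ is the Hardy space of the bidisk with coordinates $(z,w)$, in which the monomials $z^aw^b$ ($a,b\ge 0$) form an orthonormal basis. For a polynomial $p$, $[p]$ denotes the closure of $p\,\mathbb C[z,w]$ in $H^2(\mathbb D^2)$; it is a submodule, i.e. a closed subspace invariant under multiplication by $z$ and $w$. For a submodule $M$, $R_1,R_2$ are the restrictions to $M$ of multiplication by $z$ and $w$, respectively, $[A,B]=AB-BA$, and $$\Sigma_0(M)=\|[R_2^*,R_2][R_1^*,R_1]\|_{H.S.}^2,\qquad \Sigma_1(M)=\|[R_1^*,R_2]\|_{H.S.}^2,$$ where $\|\cdot\|_{H.S.}$ is the Hilbert–Schmidt norm. Higher invariants for $M=[p]$, $p\neq0$ a homogeneous polynomial: let $A^n$ ($n\ge 0$) be the $(n+1)\times(n+1)$ matrix with entries $a_{i,l}=\langle p z^{l}w^{n-l},\,p z^{i}w^{n-i}\rangle$, $0\le i,l\le n$ (a Toeplitz matrix; $a_{i,l}=\langle pw^{i-l},pz^{i-l}\rangle$ for $i\ge l$). Let $A^n_{i,l}$ be the (signed) cofactor of the entry of $A^n$ in row $i$, column $l$ (rows and columns indexed from $0$; $A^0_{0,0}=1$), and let $D_0=1$, $D_n=\det A^{n-1}$ for $n\ge1$.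 Then $$\varphi_n=\frac{\sum_{l=0}^n A^n_{0,l}\,p\,z^lw^{n-l}}{\sqrt{D_nD_{n+1}}},\qquad \psi_n=\frac{\sum_{l=0}^n A^n_{n,l}\,p\,z^lw^{n-l}}{\sqrt{D_nD_{n+1}}},\qquad n\ge0,$$ are orthonormal bases of $M\ominus zM$ and $M\ominus wM$, respectively, each $\varphi_n,\psi_n$ being homogeneous of degree $n+\deg p$. For $j\ge 2$ one defines $$\Sigma_j(M)=\sum_{n=0}^\infty |\langle w^j\varphi_n, z^j\psi_n\rangle|^2,$$ and this formula also holds for $j=0,1$. *)

(* Defs.v *)
From mathcomp Require Import all_boot all_order all_algebra.
From mathcomp Require Import all_classical all_reals all_analysis.
From mathcomp Require Import complex.

Set Implicit Arguments.
Unset Strict Implicit.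
Unset Printing Implicit Defensive.

Import Order.TTheory GRing.Theory Num.Theory.
Import numFieldNormedType.Exports.

Local Open Scope classical_set_scope.
Local Open Scope ring_scope.

(* A power series sum f(a,b) z^a w^b is given by its coefficient family f;
   H^2(D^2) is the set of square-summable families. *)
Notation coefs R := (nat * nat -> R[i])%type.

Definition normsq (R : realType) (f : coefs R) : \bar R :=
  (\esum_(ab in [set: nat * nat]) (Normc.normc (f ab) ^+ 2)%:E)%R.

Definition H2 (R : realType) : set (coefs R) :=
  [set f | (normsq f < +oo)%E].

(* For f, g in H^2 the double series converges absolutely, so the limit of the
   square partial sums is its sum. The limit is taken on real and imaginary
   parts. *)
Definition inner_partial (R : realType) (f g : coefs R) (N : nat) : R[i] :=
  \sum_(0 <= a < N) \sum_(0 <= b < N) f (a, b) * (g (a, b))^*.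

Definition inner (R : realType) (f g : coefs R) : R[i] :=
  Complex (limn (fun N => complex.Re (inner_partial f g N)))
          (limn (fun N => complex.Im (inner_partial f g N))).

Definition closureH2 (R : realType) (A : set (coefs R)) : set (coefs R) :=
  [set f | H2 f /\
    forall eps : R, 0 < eps ->
      exists2 g, A g & (normsq (f - g)%R < (eps ^+ 2)%:E)%E].

(* Polynomials in z and w, with z the outer and w the inner indeterminate. *)
Definition zvar (R : realType) : {poly {poly R[i]}} := 'X.
Definition wvar (R : realType) : {poly {poly R[i]}} := 'X%:P.

Definition coefs_of_poly (R : realType) (p : {poly {poly R[i]}}) : coefs R :=
  fun ab => p`_(ab.1)`_(ab.2).

(* [p] *)
Definition submodule_of (R : realType) (p : {poly {poly R[i]}}) :
    set (coefs R) :=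
  closureH2 [set coefs_of_poly (p * q) | q in [set: {poly {poly R[i]}}]].

Definition mulz (R : realType) (f : coefs R) : coefs R :=
  fun ab => if ab.1 is a.+1 then f (a, ab.2) else 0.
Definition mulw (R : realType) (f : coefs R) : coefs R :=
  fun ab => if ab.2 is b.+1 then f (ab.1, b) else 0.

(* Operators on a closed subspace M are maps on coefficient families of which
   only the values on M matter; thus R_1 and R_2 are mulz and mulw.
   [adj M T] is the adjoint of T as an operator on M; its value at an f in M is
   the unique element g of M with <T h, f> = <h, g> for all h in M. *)
Definition adj (R : realType) (M : set (coefs R)) (T : coefs R -> coefs R)
    (f : coefs R) : coefs R :=
  xget 0 [set g | M g /\ forall h, M h -> inner (T h) f = inner h g].

Definition comm (R : realType) (A B : coefs R -> coefs R) (f : coefs R) :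
    coefs R :=
  A (B f) - B (A f).

Definition lin_span (R : realType) (E : set (coefs R)) : set (coefs R) :=
  [set f | exists (s : seq (coefs R)) (c : coefs R -> R[i]),
    (forall e, e \in s -> E e) /\
    f = (fun ab => \sum_(e <- s) c e * e ab)].

Definition orthonormal_basis (R : realType) (M E : set (coefs R)) : Prop :=
  [/\ E `<=` M,
      forall e e', E e -> E e' -> inner e e' = (e == e')%:R
    & M `<=` closureH2 (lin_span E)].

(* The square of the Hilbert-Schmidt norm, computed on a chosen orthonormal
   basis of M (the value does not depend on it). *)
Definition HSnormsq (R : realType) (M : set (coefs R))
    (T : coefs R -> coefs R) : \bar R :=
  (\esum_(e in xget set0 [set E | orthonormal_basis M E]) normsq (T e))%R.

Definition Sigma0 (R : realType) (M : set (coefs R)) : \bar R :=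
  HSnormsq M (fun f => comm (adj M (@mulw R)) (@mulw R)
                         (comm (adj M (@mulz R)) (@mulz R) f)).

Definition Sigma1 (R : realType) (M : set (coefs R)) : \bar R :=
  HSnormsq M (comm (adj M (@mulz R)) (@mulw R)).

Definition polyA (R : realType) (p : {poly {poly R[i]}}) (n : nat) :
    'M[R[i]]_n.+1 :=
  \matrix_(i, l)
    inner (coefs_of_poly (p * zvar R ^+ l * wvar R ^+ (n - l)))
          (coefs_of_poly (p * zvar R ^+ i * wvar R ^+ (n - i))).

Definition polyD (R : realType) (p : {poly {poly R[i]}}) (n : nat) : R[i] :=
  if n is m.+1 then \det (polyA p m) else 1.

Definition row_comb (R : realType) (p : {poly {poly R[i]}}) (n : nat)
    (i : 'I_n.+1) : {poly {poly R[i]}} :=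
  ((sqrtC (polyD p n * polyD p n.+1))^-1)%:P *:
    \sum_(l < n.+1) (cofactor (polyA p n) i l)%:P *:
      (p * zvar R ^+ l * wvar R ^+ (n - l)).

Definition phi (R : realType) (p : {poly {poly R[i]}}) (n : nat) :
    {poly {poly R[i]}} :=
  row_comb p (ord0 : 'I_n.+1).

Definition psi (R : realType) (p : {poly {poly R[i]}}) (n : nat) :
    {poly {poly R[i]}} :=
  row_comb p (ord_max : 'I_n.+1).

(* Sigma_j([p]), for p a nonzero homogeneous polynomial. *)
Definition Sigma (R : realType) (j : nat) (p : {poly {poly R[i]}}) : \bar R :=
  match j with
  | 0 => Sigma0 (submodule_of p)
  | 1 => Sigma1 (submodule_of p)
  | _ => (\sum_(0 <= n <oo)
           (Normc.normc
             (inner (coefs_of_poly (wvar R ^+ j * phi p n))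
                    (coefs_of_poly (zvar R ^+ j * psi p n))) ^+ 2)%:E)%E
  end.

(* Main.v *)
Require Import Defs.
From mathcomp Require Import all_boot all_order all_algebra.
From mathcomp Require Import all_classical all_reals all_analysis.
From mathcomp Require Import complex.
From mathcomp Require Import zify ring lra.

Set Implicit Arguments.
Unset Strict Implicit.
Unset Printing Implicit Defensive.

Import Order.TTheory GRing.Theory Num.Theory.
Import numFieldNormedType.Exports.

Local Open Scope classical_set_scope.
Local Open Scope ring_scope.

(** A square-summable family lies in M_k = [z^k - w^k] iff its sums over the
    blocks {(a, b) : a + b = N, a = r mod k} all vanish. So the projection
    onto M_k subtracts block means, and the adjoints of R_1 and R_2 are
    explicit. It follows that [R_2^*, R_2][R_1^*, R_1] e and [R_1^*, R_2] e
    have entries which are explicit multiples of the axis coefficients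
    e(0, n). For every orthonormal basis of M_k, Parseval's identity for the
    projection of w^n gives that the sum of |e(0, n)|^2 over the basis is
    1 - 1/(floor(n/k) + 1), which turns the two Hilbert-Schmidt norms into
    explicit series.

    For j >= 2, put d = floor(n/k) + 1. The vector c_l = d - l/k (for l a
    multiple of k, and 0 otherwise) solves A^n c = (d + 1) e_0, so by Cramer's
    rule it is proportional to the first row of cofactors; hence phi_n is a
    multiple of the vector (-d, 1, ..., 1) along the block of w^(n+k), and
    psi_n is obtained by exchanging z and w. Therefore <w^j phi_n, z^j psi_n>
    vanishes unless k divides n + j, and then its modulus is
    max(d + 1 - m, 0)/(d (d + 1)) with m = ceil(j/k). The resulting series
    depends on k and j only through m. *)

(** * Square-summable families *)

Section SquareSummable.
Variable R : realType.
Implicit Types (f g h : coefs R) (x y : R[i]).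

(** Everything is developed for k >= 1, because the right-hand sides are the case k = 1. Axis
    coefficients appear because R_1^* is the backward shift followed by the projection onto M_k: the
    shift keeps every block sum zero except where an entry e(0, n) falls off, so the correction is a
    multiple of that single entry. The sum over the basis can therefore be carried out entry by
    entry. [HSnormsq] picks its basis by choice, so one basis has to be exhibited to exclude the
    default empty set; Helmert's vectors provide it. A second obstacle is that [inner] is a limit of
    square partial sums, while blocks lie on antidiagonals; orthogonality along antidiagonals has to
    be transferred by truncation. The value pi^2/6 comes from comparing 1/x^2 with 1/sin^2 x at
    dyadic fractions of pi/2, where the sum of 1/sin^2 has a closed form. *)

Definition normc2 x : R := Normc.normc x ^+ 2.

Lemma normc2_ge0 x : 0 <= normc2 x. Proof. exact: sqr_ge0. Qed.
Hint Resolve normc2_ge0 : core.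

Lemma normc2E x : normc2 x = complex.Re x ^+ 2 + complex.Im x ^+ 2.
Proof. by case: x => a b; rewrite /normc2 /= sqr_sqrtr// addr_ge0 ?sqr_ge0. Qed.

Lemma mul_conj_normc2 x : x * x^* = (normc2 x)%:C%C.
Proof. by rewrite -sqr_normc normc_def -rmorphXn sqr_sqrtr ?addr_ge0 ?sqr_ge0//
  normc2E. Qed.

Lemma normc2M x y : normc2 (x * y) = normc2 x * normc2 y.
Proof. by rewrite /normc2 Normc.normcM exprMn. Qed.

Lemma normc2_eq0 x : (normc2 x == 0) = (x == 0).
Proof.
rewrite /normc2 expf_eq0/=; apply/eqP/eqP => [/Normc.eq0_normc //|->].
exact: Normc.normc0.
Qed.

Lemma normc2D_le x y : normc2 (x + y) <= 2 * normc2 x + 2 * normc2 y.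
Proof. by case: x y => a b [c d]; rewrite !normc2E /=; have := sqr_ge0 (a - c);
  have := sqr_ge0 (b - d); nra. Qed.

Lemma normc2N x : normc2 (- x) = normc2 x.
Proof. by rewrite !normc2E; case: x => a b /=; rewrite !sqrrN. Qed.

Lemma normc2C (r : R) : normc2 r%:C%C = r ^+ 2.
Proof. by rewrite normc2E /= expr0n addr0. Qed.

Lemma normc2_conj x : normc2 x^* = normc2 x.
Proof. by rewrite !normc2E; case: x => a b /=; rewrite sqrrN. Qed.

Lemma normsq_ge0 f : (0 <= normsq f)%E.
Proof. by apply: esum_ge0 => ab _; rewrite lee_fin sqr_ge0. Qed.
Hint Resolve normsq_ge0 : core.

Lemma H2_fin_num f : H2 f -> normsq f \is a fin_num.
Proof. by move=> Hf; rewrite ge0_fin_numE. Qed.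

(* Junk value 0 when f is not square-summable. *)
Definition nsq f : R := fine (normsq f).

Lemma nsqE f : H2 f -> normsq f = (nsq f)%:E.
Proof. by move=> Hf; rewrite /nsq fineK // H2_fin_num. Qed.

Lemma esumZ (T : choiceType) (D : set T) (c : R) (a : T -> \bar R) :
  0 <= c -> (forall t, 0 <= a t)%E ->
  (\esum_(t in D) (c%:E * a t) = c%:E * \esum_(t in D) a t)%E.
Proof.
move=> c0 a0; rewrite /esum -ereal_supZl//; last first.
  by apply/set0P; exists 0%E, set0; [exact: fsets_set0|rewrite fsbig_set0].
congr ereal_sup; apply/seteqP; split => x /=.
  by move=> [X HX <-]; exists (\sum_(t \in X) a t)%E; [exists X|rewrite ge0_mule_fsumr].
by move=> [y [X HX <-] <-]; exists X => //; rewrite ge0_mule_fsumr.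
Qed.

Lemma normsqZ x f : normsq (fun ab => x * f ab) = ((normc2 x)%:E * normsq f)%E.
Proof.
rewrite -esumZ//; last by move=> t; rewrite lee_fin sqr_ge0.
by apply: eq_esum => ab _; rewrite -EFinM -normc2M.
Qed.

Lemma normsqD_le f g :
  (normsq (fun ab => f ab + g ab)%R <= 2%:E * normsq f + 2%:E * normsq g)%E.
Proof.
rewrite -!esumZ//; do ?[by move=> t; rewrite lee_fin sqr_ge0].
rewrite -esumD; do ?[by move=> t; rewrite mule_ge0// lee_fin sqr_ge0].
by apply: le_esum => ab _; rewrite lee_fin; exact: normc2D_le.
Qed.

Lemma H2Z x f : H2 f -> H2 (fun ab => x * f ab).
Proof. by rewrite /H2/= => Hf; rewrite normsqZ nsqE// -EFinM ltry. Qed.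

Lemma H2D f g : H2 f -> H2 g -> H2 (f + g).
Proof.
move=> Hf Hg; apply: le_lt_trans (normsqD_le f g) _.
by rewrite !nsqE// -!EFinM -EFinD ltry.
Qed.

Lemma H2N f : H2 f -> H2 (- f).
Proof.
by move=> /(H2Z (-1)); congr H2; apply: funext => ab; rewrite mulN1r.
Qed.

Lemma H2B f g : H2 f -> H2 g -> H2 (f - g).
Proof. by move=> Hf Hg; exact: H2D Hf (H2N Hg). Qed.

Lemma H2_0 : H2 (0 : coefs R).
Proof.
rewrite /H2/= /normsq esum1 ?ltry// => ab _.
by rewrite Normc.normc0 expr0n.
Qed.

Lemma H2_sum (I : Type) (s : seq I) (F : I -> coefs R) :
  (forall i, H2 (F i)) -> H2 (\sum_(i <- s) F i).
Proof. by move=> HF; apply: big_ind => //; [exact: H2_0|exact: H2D]. Qed.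

Lemma normc2_le_normsq f ab : ((normc2 (f ab))%:E <= normsq f)%E.
Proof.
apply: esum_ge; exists [set ab]; first by split.
by rewrite fsbig_set1.
Qed.

Lemma normsq_eq0 f : normsq f = 0%E -> f = 0.
Proof.
move=> f0; apply: funext => ab; apply/eqP; rewrite -normc2_eq0 eq_le normc2_ge0 andbT.
by have := normc2_le_normsq f ab; rewrite f0 lee_fin.
Qed.

(** A finite set nearly attaining the supremum lies in a triangle a + b < N. The bound is given for
    every T containing the triangle, so that it serves both for squares and for truncation by total
    degree. *)
Lemma H2_tail f (e : R) : H2 f -> 0 < e -> exists N, forall T : set (nat * nat),
  (forall ab, (ab.1 + ab.2 < N)%N -> T ab) ->
  (\esum_(ab in ~` T) (normc2 (f ab))%:E < e%:E)%E.
Proof.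
move=> Hf e0; have [_ [X [finX _] <-]] := ub_ereal_sup_adherent e0 (H2_fin_num Hf).
move=> Xe.
exists (\max_(ab <- finmap.enum_fset (fset_set X)) (ab.1 + ab.2)).+1 => T HT.
have XT : X `<=` T.
  move=> ab Xab; apply: HT; rewrite ltnS.
  apply: (@leq_bigmax_seq _ _ xpredT (fun ab : nat * nat => (ab.1 + ab.2)%N)) => //.
  by rewrite in_fset_set// inE.
have := esumID T [set: nat * nat] (fun ab => (normc2 (f ab))%:E).
rewrite !setTI => /(_ _)-/(_ (fun ab _ => normc2_ge0 _)).
rewrite -/(normsq f) nsqE// => E.
have XTle : (\sum_(ab \in X) (normc2 (f ab))%:E <= \esum_(ab in T) (normc2 (f ab))%:E)%E.
  by apply: esum_ge; exists X.
have := lt_le_trans Xe XTle; rewrite -[ereal_sup _]/(normsq f) nsqE// -EFinB.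
have : (0 <= \esum_(ab in T) (normc2 (f ab))%:E)%E by apply: esum_ge0 => ab _;
  rewrite lee_fin.
have : (0 <= \esum_(ab in ~` T) (normc2 (f ab))%:E)%E by apply: esum_ge0 => ab _;
  rewrite lee_fin.
move: E; case: (esum T _) => [u| |]; case: (esum (~` T) _) => [v| |] //=.
by rewrite -EFinD => -[->] _ _; rewrite !lte_fin; lra.
Qed.

Lemma inner_partial_nsq f N : inner_partial f f N =
  (\sum_(a < N) \sum_(b < N) normc2 (f (a : nat, b : nat)))%:C%C.
Proof.
rewrite /inner_partial big_mkord rmorph_sum; apply: eq_bigr => a _.
by rewrite big_mkord rmorph_sum; apply: eq_bigr => b _; rewrite mul_conj_normc2.
Qed.

Lemma cvg_inner_partial_nsq f : H2 f ->
  (\sum_(a < N) \sum_(b < N) normc2 (f (a : nat, b : nat))) @[N --> \oo] --> nsq f.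
Proof.
move=> Hf; apply/cvgrPdist_lt => e e0.
have [N HN] := H2_tail Hf e0.
near=> n.
have Nn : (N <= n)%N by near: n; exact: nbhs_infty_ge.
have HT ab : (ab.1 + ab.2 < N)%N -> (`I_n `*` `I_n) ab by case: ab => a b /=; lia.
have := HN _ HT.
have := esumID (`I_n `*` `I_n) [set: nat * nat] (fun ab => (normc2 (f ab))%:E).
rewrite !setTI => /(_ _)-/(_ (fun ab _ => normc2_ge0 _)).
rewrite -/(normsq f) nsqE// esum_fset; last 2 first.
- by apply: finite_setX; exact: finite_II.
- by move=> ab _; rewrite lee_fin.
have -> : (\sum_(ab \in `I_n `*` `I_n) (normc2 (f ab))%:E =
    (\sum_(a < n) \sum_(b < n) normc2 (f (a : nat, b : nat)))%:E)%E.
  transitivity (\sum_(a \in `I_n) \sum_(b \in `I_n) (normc2 (f (a, b)))%:E)%E.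
    apply: etrans (esym (pair_fsbig _ _ (finite_II n) (finite_II n))).
    by apply: eq_fsbigr => -[].
  rewrite -(fsbig_ord _ n (fun a => \sum_(b \in `I_n) (normc2 (f (a, b)))%:E)%E).
  rewrite -sumEFin; apply: eq_bigr => a _.
  by rewrite -(fsbig_ord _ n (fun b => (normc2 (f (_, b)))%:E)) sumEFin.
have : (0 <= \esum_(ab in ~` (`I_n `*` `I_n)) (normc2 (f ab))%:E)%E
  by apply: esum_ge0 => ab _; rewrite lee_fin.
case: (esum (~` _) _) => [v| |] //=.
rewrite -EFinD lee_fin lte_fin => v0 [->] ve.
by rewrite addrAC subrr add0r ger0_norm.
Unshelve. all: by end_near.
Qed.

(** Polarization entry by entry reduces the convergence of inner products to that of sums of
    squares. *)
Lemma Re_mul_conj x y :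
  complex.Re (x * y^*) = (normc2 (x + y) - normc2 x - normc2 y) / 2.
Proof. by case: x y => a b [c d]; rewrite !normc2E /=; field. Qed.

Lemma Im_mul_conj x y : complex.Im (x * y^*) =
  (normc2 (- 'i%C * x + y) - normc2 (- 'i%C * x) - normc2 y) / 2.
Proof. by case: x y => a b [c d]; rewrite !normc2E /=; field. Qed.

(** [limn] takes a default value on divergent sequences, so the algebraic laws of [inner] need
    convergence and not only the limit. *)
Definition cvg_inner f g x :=
  (fun N => complex.Re (inner_partial f g N)) @ \oo --> complex.Re x /\
  (fun N => complex.Im (inner_partial f g N)) @ \oo --> complex.Im x.

Lemma cvg_inner_eq f g x : cvg_inner f g x -> inner f g = x.
Proof.
by case: x => a b [] /= /cvg_lim Ha /cvg_lim Hb; rewrite /inner Ha// Hb.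
Qed.

Lemma ReD x y : complex.Re (x + y) = complex.Re x + complex.Re y.
Proof. by case: x y => a b []. Qed.

Lemma ImD x y : complex.Im (x + y) = complex.Im x + complex.Im y.
Proof. by case: x y => a b []. Qed.

Lemma Re_sum (I : Type) (s : seq I) (P : pred I) (F : I -> R[i]) :
  complex.Re (\sum_(i <- s | P i) F i) = \sum_(i <- s | P i) complex.Re (F i).
Proof. exact: (big_morph _ ReD). Qed.

Lemma Im_sum (I : Type) (s : seq I) (P : pred I) (F : I -> R[i]) :
  complex.Im (\sum_(i <- s | P i) F i) = \sum_(i <- s | P i) complex.Im (F i).
Proof. exact: (big_morph _ ImD). Qed.

Lemma innerP f g : H2 f -> H2 g -> cvg_inner f g (inner f g).
Proof.
move=> Hf Hg.
have H1 h (F : R[i] -> R) : H2 h ->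
    (forall x y, F (x * y^*) = (normc2 (x + y) - normc2 x - normc2 y) / 2) ->
    (forall I s P (G : I -> R[i]),
      F (\sum_(i <- s | P i) G i) = \sum_(i <- s | P i) F (G i)) ->
    cvgn (fun N => F (inner_partial h g N)).
  move=> Hh FE Fs; apply/cvg_ex; exists ((nsq (h + g) - nsq h - nsq g) / 2).
  pose S h' N := \sum_(a < N) \sum_(b < N) normc2 (h' (a : nat, b : nat)).
  rewrite (_ : (fun N => F _) = fun N => (S (h + g) N - S h N - S g N) / 2).
    by apply: cvgM; [do 2 ?apply: cvgB; apply: cvg_inner_partial_nsq => //; exact: H2D
                    |exact: cvg_cst].
  apply: funext => N; rewrite /S.
  rewrite /inner_partial big_mkord Fs -!sumrB mulr_suml; apply: eq_bigr => a _.
  rewrite big_mkord Fs -!sumrB mulr_suml; apply: eq_bigr => b _.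
  by rewrite FE.
split.
  exact: H1 Re_mul_conj Re_sum.
(* The imaginary part of x y^* is the real part of - i x y^*. *)
have := H1 (fun ab => - 'i%C * f ab) (@complex.Re R) (H2Z _ Hf) Re_mul_conj Re_sum.
rewrite (_ : (fun N => complex.Re _) = (fun N => complex.Im (inner_partial f g N))) //.
apply: funext => N; rewrite /inner_partial Re_sum Im_sum; apply: eq_bigr => a _.
rewrite Re_sum Im_sum; apply: eq_bigr => b _.
by rewrite Im_mul_conj Re_mul_conj.
Qed.

Lemma innerDl f g h : H2 f -> H2 g -> H2 h ->
  inner (f + g) h = inner f h + inner g h.
Proof.
move=> Hf Hg Hh; apply: cvg_inner_eq.
have [f1 f2] := innerP Hf Hh; have [g1 g2] := innerP Hg Hh.
have E N : inner_partial (f + g) h N = inner_partial f h N + inner_partial g h N.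
  rewrite /inner_partial -big_split; apply: eq_bigr => a _.
  by rewrite -big_split; apply: eq_bigr => b _; exact: mulrDl.
split.
  by under eq_fun do rewrite E ReD; rewrite ReD; exact: cvgD.
by under eq_fun do rewrite E ImD; rewrite ImD; exact: cvgD.
Qed.

Lemma innerZl x f g : H2 f -> H2 g ->
  inner (fun ab => x * f ab) g = x * inner f g.
Proof.
move=> Hf Hg; apply: cvg_inner_eq; have [f1 f2] := innerP Hf Hg.
have E N : inner_partial (fun ab => x * f ab) g N = x * inner_partial f g N.
  rewrite /inner_partial mulr_sumr; apply: eq_bigr => a _.
  by rewrite mulr_sumr; apply: eq_bigr => b _; rewrite mulrA.
have ReM y z : complex.Re (y * z) =
    complex.Re y * complex.Re z - complex.Im y * complex.Im z.
  by case: y z => a b [].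
have ImM y z : complex.Im (y * z) =
    complex.Re y * complex.Im z + complex.Im y * complex.Re z.
  by case: y z => a b [].
split.
  by under eq_fun do rewrite E ReM; rewrite ReM; apply: cvgB; apply: cvgM => //;
    exact: cvg_cst.
by under eq_fun do rewrite E ImM; rewrite ImM; apply: cvgD; apply: cvgM => //;
  exact: cvg_cst.
Qed.

Lemma inner_conj f g : H2 f -> H2 g -> inner g f = (inner f g)^*.
Proof.
move=> Hf Hg; apply: cvg_inner_eq; have [f1 f2] := innerP Hf Hg.
have E N : inner_partial g f N = (inner_partial f g N)^*.
  rewrite /inner_partial rmorph_sum; apply: eq_bigr => a _.
  by rewrite rmorph_sum; apply: eq_bigr => b _; rewrite rmorphM /= conjCK mulrC.
have ReC y : complex.Re y^* = complex.Re y by case: y.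
have ImC y : complex.Im y^* = - complex.Im y by case: y.
split.
  by under eq_fun do rewrite E ReC; rewrite ReC.
by under eq_fun do rewrite E ImC; rewrite ImC; exact: cvgN.
Qed.

Lemma inner_nsq f : H2 f -> inner f f = (nsq f)%:C%C.
Proof.
move=> Hf; apply: cvg_inner_eq.
by split; under eq_fun do rewrite inner_partial_nsq;
  [exact: cvg_inner_partial_nsq|exact: cvg_cst].
Qed.

Lemma innerDr f g h : H2 f -> H2 g -> H2 h ->
  inner h (f + g) = inner h f + inner h g.
Proof.
move=> Hf Hg Hh; rewrite (inner_conj (H2D Hf Hg) Hh) innerDl// rmorphD.
by rewrite /= -(inner_conj Hf Hh) -(inner_conj Hg Hh).
Qed.

Lemma innerZr x f g : H2 f -> H2 g ->
  inner g (fun ab => x * f ab) = x^* * inner g f.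
Proof.
by move=> Hf Hg; rewrite (inner_conj (H2Z x Hf) Hg) innerZl// rmorphM /= -inner_conj.
Qed.

Lemma innerNl f g : H2 f -> H2 g -> inner (- f) g = - inner f g.
Proof.
move=> Hf Hg; rewrite -[RHS]mulN1r -innerZl//; congr inner.
by apply: funext => ab; rewrite mulN1r.
Qed.

Lemma innerNr f g : H2 f -> H2 g -> inner g (- f) = - inner g f.
Proof.
by move=> Hf Hg; rewrite (inner_conj (H2N Hf) Hg) innerNl// rmorphN /= -inner_conj.
Qed.

Lemma innerBl f g h : H2 f -> H2 g -> H2 h ->
  inner (f - g) h = inner f h - inner g h.
Proof. by move=> Hf Hg Hh; rewrite innerDl ?innerNl//; exact: H2N. Qed.

Lemma innerBr f g h : H2 f -> H2 g -> H2 h ->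
  inner h (f - g) = inner h f - inner h g.
Proof. by move=> Hf Hg Hh; rewrite innerDr ?innerNr//; exact: H2N. Qed.

Lemma inner0l g : H2 g -> inner 0 g = 0.
Proof.
by move=> Hg; have := innerBl H2_0 H2_0 Hg; rewrite !subrr.
Qed.

Lemma sum_antidiag (V : nmodType) (F : nat -> nat -> V) n N : (n < N)%N ->
  (forall a b, (a + b != n)%N -> F a b = 0) ->
  \sum_(0 <= a < N) \sum_(0 <= b < N) F a b = \sum_(i < n.+1) F i (n - i)%N.
Proof.
move=> nN F0; rewrite (@big_cat_nat _ _ _ n.+1)//=.
rewrite [X in _ + X]big1_seq ?addr0; last first.
  move=> a; rewrite mem_index_iota => /andP[_ /andP[na _]].
  by rewrite big1 // => b _; rewrite F0//; lia.
rewrite big_mkord; apply: eq_bigr => -[a /= an] _.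
rewrite (bigD1_seq (n - a)%N) ?iota_uniq ?mem_index_iota//=; last by lia.
by rewrite big1 ?addr0// => b bn; rewrite F0//; lia.
Qed.

(** The square partial sums are constant as soon as the square contains the antidiagonal that
    carries g. *)
Lemma inner_antidiag f g n : (forall ab, (ab.1 + ab.2 != n)%N -> g ab = 0) ->
  inner f g = \sum_(i < n.+1) f (i : nat, (n - i)%N) * (g (i : nat, (n - i)%N))^*.
Proof.
move=> g0; apply: cvg_inner_eq.
have E : \forall N \near \oo, inner_partial f g N =
    \sum_(i < n.+1) f (i : nat, (n - i)%N) * (g (i : nat, (n - i)%N))^*.
  near=> N; rewrite /inner_partial.
  rewrite (@sum_antidiag _ (fun a b => f (a, b) * (g (a, b))^*) n)//.
    by near: N; exact: nbhs_infty_gt.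
  by move=> a b abn; rewrite g0// rmorph0 mulr0.
by split; apply: cvg_near_cst; apply: filterS E => N ->.
Unshelve. all: by end_near.
Qed.

End SquareSummable.

(** * Bessel's inequality and Parseval's identity *)

Section Bessel.
Variable R : realType.
Implicit Types (f g h x : coefs R) (E M : set (coefs R)).

Lemma nsqB_orth_scale x e (c : R[i]) : H2 x -> H2 e -> inner e e = 1 ->
  nsq (x - (fun ab => c * e ab)) =
  nsq x - normc2 (inner x e) + normc2 (c - inner x e).
Proof.
move=> Hx He e1; apply: (@complexI R).
have Hc := H2Z c He.
rewrite -inner_nsq; last exact: H2B.
rewrite innerBl ?innerBr//; try exact: H2B.
rewrite !innerZr ?innerZl// e1 inner_nsq// (inner_conj Hx He).
rewrite rmorphD rmorphB /= -!mul_conj_normc2 rmorphB /=; ring.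
Qed.

Lemma inner_comb_l (s : seq (coefs R)) (c : coefs R -> R[i]) g :
  H2 g -> (forall e, e \in s -> H2 e) ->
  H2 (fun ab => \sum_(e <- s) c e * e ab) /\
  inner (fun ab => \sum_(e <- s) c e * e ab) g = \sum_(e <- s) c e * inner e g.
Proof.
move=> Hg; elim: s => [_|e s IH Hs].
  have -> : (fun ab => \sum_(e <- [::]) c e * e ab) = 0 :> coefs R.
    by apply: funext => ab; rewrite big_nil.
  by split; [exact: H2_0|rewrite big_nil inner0l].
have [|H0 IH0] := IH; first by move=> e' e's; apply: Hs; rewrite inE e's orbT.
have He : H2 e by apply: Hs; rewrite mem_head.
have -> : (fun ab => \sum_(e <- e :: s) c e * e ab) =
    (fun ab => c e * e ab) + (fun ab => \sum_(e <- s) c e * e ab).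
  by apply: funext => ab; rewrite big_cons.
have Hce := H2Z (c e) He.
by split; [exact: H2D|rewrite innerDl// innerZl// IH0 big_cons].
Qed.

(** Both halves of Parseval's identity come from this: c e = [inner x e] gives Bessel's inequality,
    and dropping the last, nonnegative sum bounds [nsq x] by the sum of squares plus the
    approximation error. *)
Lemma nsqB_comb x (s : seq (coefs R)) (c : coefs R -> R[i]) :
  H2 x -> uniq s -> (forall e, e \in s -> H2 e) ->
  (forall e e', e \in s -> e' \in s -> inner e e' = (e == e')%:R) ->
  nsq (x - (fun ab => \sum_(e <- s) c e * e ab)) =
  nsq x - \sum_(e <- s) normc2 (inner x e) + \sum_(e <- s) normc2 (c e - inner x e).
Proof.
move=> Hx; elim: s => [_ _ _|e s IH /= /andP[es us] Hs os].
  have -> : (fun ab => \sum_(e <- [::]) c e * e ab) = 0 :> coefs R.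
    by apply: funext => ab; rewrite big_nil.
  by rewrite !big_nil !subr0 addr0.
have Hs' e' : e' \in s -> H2 e' by move=> e's; apply: Hs; rewrite inE e's orbT.
have IH0 : _ := IH us Hs' _.
have He : H2 e by apply: Hs; rewrite mem_head.
have [H0 ye] := inner_comb_l c He Hs'.
set y := (fun ab => _) in H0 IH0 ye.
have -> : (fun ab => \sum_(e <- e :: s) c e * e ab) = y + (fun ab => c e * e ab).
  by apply: funext => ab; rewrite big_cons addrC.
have y0 : inner y e = 0.
  rewrite ye big_seq big1// => e' e's.
  rewrite os ?inE ?eqxx ?e's ?orbT// (negbTE (memPn es _ e's)) mulr0 //.
rewrite opprD addrA nsqB_orth_scale//; last 2 first.
- exact: H2B.
- by rewrite os ?mem_head// eqxx.
rewrite innerBl// y0 subr0 IH0; last first.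
  by move=> e1 e2 e1s e2s; apply: os; rewrite inE ?e1s ?e2s orbT.
rewrite !big_cons; ring.
Qed.

(** The list in [lin_span] may repeat a vector; its coefficient is then multiplied by the number of
    occurrences. *)
Lemma lin_span_uniq E f : lin_span E f -> exists s c,
  [/\ uniq s, forall e, e \in s -> E e & f = (fun ab => \sum_(e <- s) c e * e ab)].
Proof.
move=> [s [c [sE ->]]]; exists (undup s), (fun e => c e *+ count_mem e s).
split; [exact: undup_uniq|by move=> e; rewrite mem_undup; exact: sE|].
apply: funext => ab; rewrite -big_undup_iterop_count; apply: eq_bigr => e _.
by rewrite mulrnAl.
Qed.

Lemma parseval M E x : M `<=` @H2 R -> orthonormal_basis M E -> M x ->
  (\esum_(e in E) (normc2 (inner x e))%:E)%E = (nsq x)%:E.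
Proof.
move=> MH [EM oE Mspan] Mx.
have Hx := MH _ Mx.
have HE e : E e -> H2 e by move=> /EM/MH.
apply/eqP; rewrite eq_le; apply/andP; split.
  apply: ge_ereal_sup => _ [X [finX XE] <-].
  rewrite fsbig_finite//= sumEFin lee_fin.
  set s := finmap.enum_fset _.
  have sE e : e \in s -> E e by rewrite in_fset_set// inE => /XE.
  have := @nsqB_comb x s (fun e => inner x e) Hx (finmap.fset_uniq _) (fun e es =>
    HE e (sE e es)) (fun e e' es es' => oE _ _ (sE _ es) (sE _ es')).
  rewrite [X in _ = _ + X]big1 ?addr0; last by move=> e _;
    rewrite subrr normc2E expr0n addr0.
  move=> E1; rewrite -subr_ge0 -E1; exact: fine_ge0 (normsq_ge0 _).
apply/lee_addgt0Pr => e e0.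
have [_ /(_ (Num.sqrt e))] := Mspan _ Mx.
rewrite sqrtr_gt0 => /(_ e0)[y /lin_span_uniq[s [c [us sE ->]]]].
rewrite (sqr_sqrtr (ltW e0)) => xy.
have [Hy _] := inner_comb_l c (@H2_0 R) (fun e es => HE e (sE e es)).
move: xy; rewrite nsqE; last exact: H2B.
rewrite nsqB_comb//; [|by move=> ? /sE/HE|by move=> ? ? /sE ? /sE; exact: oE].
rewrite lte_fin => xy.
apply: (@le_trans _ _ ((\sum_(e <- s) normc2 (inner x e))%:E + e%:E)%E).
  rewrite -EFinD lee_fin.
  have : 0 <= \sum_(e <- s) normc2 (c e - inner x e) by apply: sumr_ge0 => *;
    exact: normc2_ge0.
  lra.
rewrite leeD2r//; apply: esum_ge; exists [set` s].
  by split; [exact: finite_seq|move=> ? /=; exact: sE].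
by rewrite -fsbig_seq// sumEFin.
Qed.
End Bessel.

(** * The submodule generated by z^k - w^k *)

Section Submodule.
Variable R : realType.
Implicit Types (f g h : coefs R) (p q : {poly {poly R[i]}}).

Lemma coefs_of_polyB p q : coefs_of_poly (p - q) = coefs_of_poly p - coefs_of_poly q.
Proof. by apply: funext => ab; rewrite /coefs_of_poly !coefB. Qed.

Lemma coefs_of_poly0 : coefs_of_poly (0 : {poly {poly R[i]}}) = 0.
Proof. by apply: funext => ab; rewrite /coefs_of_poly !coef0. Qed.

Lemma coefs_of_polyZ (c : R[i]) p ab :
  coefs_of_poly (c%:P *: p) ab = c * coefs_of_poly p ab.
Proof. by rewrite /coefs_of_poly coefZ coefCM. Qed.

Lemma coefs_of_poly_sum (I : Type) (s : seq I) (F : I -> {poly {poly R[i]}}) ab :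
  coefs_of_poly (\sum_(i <- s) F i) ab = \sum_(i <- s) coefs_of_poly (F i) ab.
Proof. by rewrite /coefs_of_poly !coef_sum. Qed.

Lemma coefs_of_poly_zX (n : nat) p a b : coefs_of_poly (zvar R ^+ n * p) (a, b) =
  if (a < n)%N then 0 else coefs_of_poly p ((a - n)%N, b).
Proof. by rewrite /coefs_of_poly /zvar coefXnM /=; case: ifP; rewrite ?coef0. Qed.

Lemma coefs_of_poly_wX (n : nat) p a b : coefs_of_poly (wvar R ^+ n * p) (a, b) =
  if (b < n)%N then 0 else coefs_of_poly p (a, (b - n)%N).
Proof. by rewrite /coefs_of_poly /wvar -rmorphXn coefCM coefXnM. Qed.

Lemma coefs_of_poly1 a b : coefs_of_poly (1 : {poly {poly R[i]}}) (a, b) =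
  ((a == 0) && (b == 0))%:R.
Proof. by rewrite /coefs_of_poly coef1 /=; case: (a == 0); rewrite ?coef0 ?coef1. Qed.

Lemma coefs_of_monomial i j a b : coefs_of_poly (zvar R ^+ i * wvar R ^+ j) (a, b) =
  ((a == i) && (b == j))%:R.
Proof.
rewrite coefs_of_poly_zX -[wvar R ^+ j]mulr1 coefs_of_poly_wX coefs_of_poly1.
case: ltnP => ai; first by rewrite ltn_eqF.
case: ltnP => bj; first by rewrite [b == j]ltn_eqF// andbF.
by congr (_ && _)%:R; lia.
Qed.

Lemma H2_finite f N : (forall ab, (N <= ab.1 + ab.2)%N -> f ab = 0) -> H2 f.
Proof.
move=> f0; rewrite /H2/=.
have := esumID [set ab : nat * nat | (ab.1 + ab.2 < N)%N] [set: nat * nat] (fun ab =>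
  (normc2 (f ab))%:E).
rewrite !setTI => /(_ _)-/(_ (fun ab _ => normc2_ge0 _)).
rewrite -/(normsq f) [X in (_ + X)%E]esum1 => [->|]; last first.
  move=> ab /= /negP; rewrite -leqNgt => abN.
  by rewrite f0// normc2E/= expr0n addr0.
have fin : finite_set [set ab : nat * nat | (ab.1 + ab.2 < N)%N].
  apply: sub_finite_set (finite_setX (finite_II N) (finite_II N)) => -[a b] /=; lia.
rewrite esum_fset//; last by move=> ab _; rewrite lee_fin normc2_ge0.
by rewrite fsbig_finite//= sumEFin adde0 ltry.
Qed.

Lemma H2_poly p : H2 (coefs_of_poly p).
Proof.
pose N := (size p + \max_(i < size p) size (p`_i)%R)%N.
apply: (@H2_finite _ N) => -[a b] /= abN; rewrite /coefs_of_poly /=.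
case: (ltnP a (size p)) => ap; last by rewrite (nth_default _ ap) coef0.
rewrite nth_default//.
have := leq_bigmax (F := fun i : 'I_(size p) => size p`_i) (Ordinal ap) => /=.
move=> H; apply: leq_trans H _; rewrite -(leq_add2l a).
by apply: leq_trans abN; rewrite leq_add2r ltnW.
Qed.

Variable k : nat.
Hypothesis k0 : (0 < k)%N.

Let gen := zvar R ^+ k - wvar R ^+ k.

Lemma coefs_of_gen_mul q a b : coefs_of_poly (gen * q) (a, b) =
  (if (a < k)%N then 0 else coefs_of_poly q ((a - k)%N, b)) -
  (if (b < k)%N then 0 else coefs_of_poly q (a, (b - k)%N)).
Proof.
by rewrite mulrBl coefs_of_polyB -coefs_of_poly_zX -coefs_of_poly_wX.
Qed.

(** The monomials of one block are congruent modulo [gen], so this is the coefficient of their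
    common class in the quotient ring. *)
Definition block_sum f (N r : nat) : R[i] :=
  \sum_(0 <= i < N.+1 | i == r %[mod k]) f (i, (N - i)%N).

Lemma block_sumB f g N r : block_sum (f - g) N r = block_sum f N r - block_sum g N r.
Proof. by rewrite /block_sum -sumrB. Qed.

(** Multiplication by z^k moves the first exponent by k, within its residue class, so z^k q and w^k
    q have the same block sums. *)
Lemma block_sum_gen_mul q N r : block_sum (coefs_of_poly (gen * q)) N r = 0.
Proof.
rewrite /block_sum; under eq_bigr do rewrite coefs_of_gen_mul.
rewrite sumrB; case: (ltnP N k) => Nk.
  rewrite big1_seq ?[X in _ - X]big1_seq ?subrr// => i.
    by rewrite mem_index_iota => /andP[_ iN]; rewrite ifT//; lia.
  by rewrite mem_index_iota => /andP[_ iN]; rewrite ifT//; lia.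
have -> : N = (N - k + k)%N by lia.
set N' := (N - k)%N; apply/eqP; rewrite subr_eq0; apply/eqP.
rewrite (@big_cat_nat _ _ _ k)//=; last by lia.
rewrite big1_seq ?add0r; last first.
  by move=> i; rewrite mem_index_iota => /andP[_ iN]; rewrite ifT//; lia.
rewrite -{1}(add0n k) big_addn.
rewrite [RHS](@big_cat_nat _ _ _ N'.+1)//=; last by lia.
rewrite [X in _ = _ + X]big1_seq ?addr0; last first.
  by move=> i; rewrite mem_index_iota => /andP[_ iN]; rewrite ifT//; lia.
rewrite (_ : ((N' + k).+1 - k)%N = N'.+1); last by lia.
apply: congr_big_nat => // i; first by rewrite modnDr.
move=> /andP[_ /andP[_ iN]].
rewrite !ifF; try lia.
by congr (coefs_of_poly q (_, _)); lia.
Qed.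

Definition zero_blocks : set (coefs R) := [set f | H2 f /\ forall N r, block_sum f N r = 0].

(** Block sums are continuous for the H2 norm, which dominates every entry; this carries their
    vanishing over to the closure. *)
Lemma normc_block_sum f N r (e : R) : (forall ab, Normc.normc (f ab) <= e) ->
  Normc.normc (block_sum f N r) <= e *+ N.+1.
Proof.
move=> fe; have e0 : 0 <= e by apply: le_trans (fe (0, 0)%N); case: (f _) => a b;
  exact: sqrtr_ge0.
rewrite /block_sum -[in leRHS](subn0 N.+1) -sumr_const_nat big_mkcond.
elim/big_ind2 : _ => [|x1 x2 y1 y2 H1 H2|i _].
- by rewrite Normc.normc0.
- by apply: le_trans (le_normcD _ _) _; exact: lerD.
- by case: ifP => _; rewrite ?Normc.normc0.
Qed.

(** Normal form modulo [gen]: every monomial is congruent to one with z-degree below k. *)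
Lemma diff_in_gen_ideal a b : exists q, zvar R ^+ a * wvar R ^+ b -
  zvar R ^+ (a %% k) * wvar R ^+ (b + k * (a %/ k)) = gen * q.
Proof.
have [t ] : exists t, zvar R ^+ (k * (a %/ k)) - wvar R ^+ (k * (a %/ k)) = gen * t.
  by rewrite !exprM subrXX; eexists; reflexivity.
move=> E; exists (zvar R ^+ (a %% k) * wvar R ^+ b * t).
rewrite mulrCA -E {1}(divn_eq a k) exprD exprD [(a %/ k * k)%N]mulnC; ring.
Qed.

(** Each monomial of f is replaced by its normal form at the cost of a multiple of [gen]. What
    remains has the block sums as coefficients, hence is 0. *)
Lemma gen_ideal_finite f N : (forall ab, (N <= ab.1 + ab.2)%N -> f ab = 0) ->
  (forall n r, block_sum f n r = 0) -> exists q, f = coefs_of_poly (gen * q).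
Proof.
move=> f0 fb; have [Q HQ] := choice (fun ab : nat * nat => diff_in_gen_ideal ab.1 ab.2).
exists (\sum_(0 <= a < N) \sum_(0 <= b < N) (f (a, b))%:P *: Q (a, b)).
apply: funext => -[x y].
rewrite mulr_sumr coefs_of_poly_sum.
transitivity (\sum_(0 <= a < N) \sum_(0 <= b < N) f (a, b) *
  (((x == a) && (y == b))%:R - ((x == a %% k) && (y == b + k * (a %/ k)))%N%:R));
    last first.
  apply: eq_bigr => a _; rewrite mulr_sumr coefs_of_poly_sum; apply: eq_bigr => b _.
  by rewrite -scalerAr coefs_of_polyZ -HQ coefs_of_polyB -!coefs_of_monomial.
have aE a : a = (k * (a %/ k) + a %% k)%N by rewrite mulnC -divn_eq.
have neq a b : (a + b != x + y)%N -> (x == a) && (y == b) = false /\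
    (x == a %% k)%N && (y == b + k * (a %/ k))%N = false.
  have := aE a; move: (k * _)%N (a %% k)%N => c d ac abxy.
  by split; apply/negbTE; lia.
case: (ltnP (x + y) N) => xyN; last first.
  rewrite f0// big1// => a _; rewrite big1// => b _.
  case: (ltnP (a + b) N) => abN; last by rewrite f0 ?mul0r.
  by have [-> ->] := neq a b ltac:(lia); rewrite subrr mulr0.
rewrite (@sum_antidiag _ _ (x + y))//; last first.
  move=> a b abn.
  by have [-> ->] := neq a b ltac:(lia); rewrite subrr mulr0.
under eq_bigr do rewrite mulrBr.
(* The first sum is the entry of f. The second collects the normal forms; at (x, y) it is a block
   sum if x < k and 0 otherwise. *)
rewrite sumrB [X in _ - X](_ : _ = 0).
  rewrite subr0 (bigD1 (inord x)) //= inordK; last by lia.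
  rewrite addKn !eqxx mulr1 big1 ?addr0// => i.
  rewrite -val_eqE /= inordK; last by lia.
  by rewrite eq_sym => /negbTE ->; rewrite mulr0.
case: (ltnP x k) => xk; last first.
  rewrite big1// => i _; rewrite [_ && _]negbTE ?mulr0//.
  by have := ltn_pmod i k0; lia.
rewrite -[RHS](fb (x + y)%N x) /block_sum big_mkord [RHS]big_mkcond.
apply: eq_bigr => -[a /= an] _.
rewrite (modn_small xk) eq_sym; case: eqVneq => ax; rewrite ?mulr0//=.
by have := aE a; rewrite (_ : _ == _) ?mulr1//; lia.
Qed.

Lemma submodule_genE : submodule_of gen = zero_blocks.
Proof.
apply/seteqP; split => f [Hf fA]; split => //.
  move=> N r; apply: Normc.eq0_normc; apply/eqP; rewrite eq_le.
  apply/andP; split; last by case: (block_sum _ _ _) => a b; exact: sqrtr_ge0.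
  apply/ler_addgt0Pr => e e0; rewrite add0r.
  have e'0 : 0 < e / N.+1%:R by rewrite divr_gt0.
  have [_ [q _ <-] fq] := fA _ e'0.
  have -> : block_sum f N r = block_sum (f - coefs_of_poly (gen * q)) N r.
    by rewrite block_sumB block_sum_gen_mul subr0.
  rewrite (_ : e = (e / N.+1%:R) *+ N.+1); last by rewrite -mulr_natr divfK.
  apply: normc_block_sum => ab; rewrite -(@ler_pXn2r _ 2)//; last 2 first.
  - by rewrite nnegrE; case: ((f - _) _) => a b; exact: sqrtr_ge0.
  - by rewrite nnegrE ltW.
  rewrite -lee_fin; apply: le_trans (normc2_le_normsq _ _) (ltW fq).
move=> e e0; have e20 : 0 < e ^+ 2 by rewrite exprn_gt0.
have [N HN] := H2_tail Hf e20.
(* Truncation by total degree keeps or deletes whole blocks, so the block sums of g still vanish. *)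
pose g : coefs R := fun ab => if (ab.1 + ab.2 < N)%N then f ab else 0.
have [q gq] : exists q, g = coefs_of_poly (gen * q).
  apply: (@gen_ideal_finite g N); first by move=> ab; rewrite /g ltnNge => ->.
  move=> n r; case: (ltnP n N) => nN.
    rewrite -(fA n r); apply: congr_big_nat => // i /andP[_ /andP[_ iN]].
    by rewrite /g /= ifT//; lia.
  rewrite /block_sum big1_seq// => i; rewrite mem_index_iota => /andP[_ iN].
  by rewrite /g /= ifF//; lia.
exists g; first by exists q.
have := HN [set ab | (ab.1 + ab.2 < N)%N] (fun _ => id).
apply: le_lt_trans; rewrite [leRHS]esum_mkcond; apply: le_esum => ab _.
have fgE : (f - g) ab = f ab - (if (ab.1 + ab.2 < N)%N then f ab else 0) by [].
rewrite fgE; case: ifPn => abN.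
  by rewrite subrr Normc.normc0 expr0n/=; case: ifP => _; rewrite // lee_fin normc2_ge0.
by rewrite subr0 mem_set//=; exact/negP.
Qed.

End Submodule.

(** * Sums over pairs of naturals, isometries *)

Section EsumNat.
Variable R : realType.

Lemma esum_support_image (T T' : choiceType) (e : T -> T') (a : T' -> \bar R) :
  injective e -> (forall y, (forall x, e x <> y) -> a y = 0%E) ->
  (\esum_(y in [set: T']) a y = \esum_(x in [set: T]) a (e x))%E.
Proof.
move=> ei a0; rewrite -(@esum_image _ _ _ setT e a); last by move=> x y _ _ /ei.
rewrite [RHS]esum_mkcond; apply: eq_esum => y _.
case: ifPn => // /negP ey; apply: a0 => x exy; apply: ey.
by rewrite inE; exists x.
Qed.

Lemma esum_comp_le (T T' : choiceType) (e : T -> T') (a : T' -> \bar R) :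
  injective e -> (forall y, 0 <= a y)%E ->
  (\esum_(x in [set: T]) a (e x) <= \esum_(y in [set: T']) a y)%E.
Proof.
move=> ei a0; rewrite -(@esum_image _ _ _ setT e a); last by move=> x y _ _ /ei.
by rewrite esum_mkcond; apply: le_esum => y _; case: ifP.
Qed.

Lemma esum_exchange (T T' : choiceType) (D : set T) (D' : set T') (a : T -> T' -> \bar R) :
  (forall x y, 0 <= a x y)%E ->
  (\esum_(x in D) \esum_(y in D') a x y = \esum_(y in D') \esum_(x in D) a x y)%E.
Proof.
move=> a0; rewrite !esum_esum//.
rewrite (@reindex_esum _ _ _ (D' `*`` (fun=> D)) (D `*`` (fun=> D')) (fun p =>
  (p.2, p.1)))//.
split => /= [[x y] []//|[x y] [x' y'] _ _ [-> ->]//|[x y] [Dx Dy]].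
by exists (y, x).
Qed.

Lemma esum_antidiag (F : nat * nat -> R) : (forall ab, 0 <= F ab) ->
  (\esum_(ab in [set: nat * nat]) (F ab)%:E =
   \esum_(n in [set: nat]) (\sum_(i < n.+1) F (i : nat, (n - i)%N))%:E)%E.
Proof.
move=> F0.
have -> : [set: nat * nat] = \bigcup_(n in [set: nat]) [set ab | (ab.1 + ab.2 = n)%N].
  by apply/seteqP; split => // ab _; exists (ab.1 + ab.2)%N.
rewrite esum_bigcupT; last 2 first.
- by move=> n m _ _ [ab [/= <- <-]].
- by move=> ab; rewrite lee_fin.
apply: eq_esum => n _; rewrite -sumEFin.
rewrite (@fsbig_ord _ _ _ n.+1 (fun i => (F (i, (n - i)%N))%:E)).
rewrite -esum_fset; [|exact: finite_II|by move=> *; rewrite lee_fin].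
apply: (@reindex_esum _ _ _ _ _ (fun i => (i, n - i)%N)); split => /=.
- by move=> i /=; lia.
- by move=> i j _ _ [].
- move=> [a b] /= abn; exists a => /=; first by lia.
  by congr pair; lia.
Qed.

Lemma sum_dvd_const (V : nmodType) (y : V) k n : (0 < k)%N ->
  \sum_(0 <= i < n | (k %| i.+1)%N) y = y *+ (n %/ k).
Proof.
move=> k0; rewrite divn_count_dvd// big_add1 /= -sumrMnr big_mkcond.
by apply: eq_bigr => i _; case: (k %| _)%N.
Qed.
End EsumNat.

Section Isometry.
Variable R : realType.
Implicit Types (f g h : coefs R).

Lemma nsqD f g : H2 f -> H2 g ->
  nsq (f + g) = nsq f + nsq g + 2 * complex.Re (inner f g).
Proof.
move=> Hf Hg; have := inner_nsq (H2D Hf Hg).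
rewrite innerDl ?innerDr//; try exact: H2D.
rewrite (inner_conj Hf Hg) !inner_nsq// => /(congr1 (@complex.Re R)).
by case: (inner f g) => a b /= <-; ring.
Qed.

(** The norms of f, g and f + g determine the real part of the inner product; replacing f by - i f
    gives the imaginary part. *)
Lemma inner_isometry (T : coefs R -> coefs R) f g :
  (forall f, H2 f -> H2 (T f) /\ nsq (T f) = nsq f) ->
  (forall f g, T (f + g) = T f + T g) ->
  (forall x f, T (fun ab => x * f ab) = fun ab => x * T f ab) ->
  H2 f -> H2 g -> inner (T f) (T g) = inner f g.
Proof.
move=> iT TD TZ Hf Hg.
have HRe f' : H2 f' -> complex.Re (inner (T f') (T g)) = complex.Re (inner f' g).
  move=> Hf'; have [Hf1 Ef1] := iT _ Hf'; have [Hg1 Eg1] := iT _ Hg.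
  have := nsqD Hf1 Hg1; rewrite -TD (iT _ (H2D Hf' Hg)).2 nsqD// Ef1 Eg1; lra.
have := HRe _ Hf; have := HRe _ (H2Z (- 'i%C) Hf).
have [Hf1 Ef1] := iT _ Hf; have [Hg1 Eg1] := iT _ Hg.
rewrite TZ !innerZl//.
case: (inner (T f) (T g)) (inner f g) => a b [c d] /= ? ?; congr Complex; lra.
Qed.

(** Cauchy-Schwarz with the bound e in place of the squared norm of g, which may vanish: expand the
    squared norm of f - t g with t = <f, g>/e. *)
Lemma inner_small f g (e : R) : H2 f -> H2 g -> 0 < e -> nsq g <= e ->
  normc2 (inner f g) <= e * nsq f.
Proof.
move=> Hf Hg e0 ge.
set c := inner f g.
pose t : R[i] := e^-1%:C%C * c.
have Ht := H2Z t Hg.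
have H0 : 0 <= nsq (f + (fun ab => - t * g ab)).
  exact: fine_ge0 (normsq_ge0 _).
move: H0; rewrite nsqD//; last exact: H2Z.
rewrite innerZr// -/c /t.
have -> : nsq (fun ab => - (e^-1%:C%C * c) * g ab) = e^-1 ^+ 2 * normc2 c * nsq g.
  by rewrite /nsq normsqZ fineM// ?H2_fin_num//= normc2N normc2M normc2C.
have -> : complex.Re ((- (e^-1%:C%C * c))^* * c) = - e^-1 * normc2 c.
  by rewrite /c normc2E; case: (inner f g) => u v /=; ring.
have c0 := normc2_ge0 c; move: (normc2 c) c0 => C c0 H0.
have : e * e^-1 = 1 by rewrite mulfV// gt_eqF.
have ei : 0 < e^-1 by rewrite invr_gt0.
move: (e^-1) ei H0 => d d0 H0 ed.
have : d ^+ 2 * C * nsq g <= d * C.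
  apply: (@le_trans _ _ (d ^+ 2 * C * e)); first by rewrite ler_wpM2l// mulr_ge0// sqr_ge0.
  by rewrite (_ : d ^+ 2 * C * e = (e * d) * (d * C)); [rewrite ed mul1r|ring].
move=> H1; have H2 : d * C <= nsq f by lra.
rewrite (_ : C = e * (d * C)); last by rewrite mulrA ed mul1r.
by rewrite ler_wpM2l// ltW.
Qed.

(* The square partial sums cut the antidiagonals, so the conclusion is obtained
   from truncations of g along antidiagonals and inner_small. *)
Lemma inner_antidiag_eq0 f g : H2 f -> H2 g ->
  (forall n, \sum_(i < n.+1) f (i : nat, (n - i)%N) * (g (i : nat, (n - i)%N))^* = 0) ->
  inner f g = 0.
Proof.
move=> Hf Hg fg0; apply/eqP; rewrite -normc2_eq0 eq_le normc2_ge0 andbT.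
have f10 : 0 < nsq f + 1 by rewrite ltr_wpDl// fine_ge0// normsq_ge0.
apply/ler_addgt0Pr => e e0; rewrite add0r.
have d0 : 0 < e / (nsq f + 1) by rewrite divr_gt0.
have [N HN] := H2_tail Hg d0.
pose gd n : coefs R := fun ab => if (ab.1 + ab.2 == n)%N then g ab else 0.
have Hgd n : H2 (gd n).
  by apply: (@H2_finite _ _ n.+1) => ab; rewrite /gd; case: eqP => // ->; rewrite ltnn.
pose g1 := \sum_(n < N) gd n.
have Hg1 : H2 g1 by exact: H2_sum.
have g1E ab : g1 ab = if (ab.1 + ab.2 < N)%N then g ab else 0.
  rewrite /g1 fct_sumE; case: ifPn => [abN|].
    rewrite (bigD1 (Ordinal abN))//= /gd eqxx big1 ?addr0// => i.
    by rewrite -val_eqE /= eq_sym => /negbTE ->.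
  move=> abN; rewrite big1// => i _; rewrite /gd ifF//; apply/negbTE.
  by have := ltn_ord i; lia.
have g10 : inner f g1 = 0.
  suff: H2 g1 /\ inner f g1 = 0 by case.
  apply: (big_ind (fun g' => H2 g' /\ inner f g' = 0)).
  - by split; [exact: H2_0|rewrite (inner_conj (@H2_0 R) Hf) inner0l// rmorph0].
  - by move=> x y [Hx x0] [Hy y0]; split; [exact: H2D|rewrite innerDr// x0 y0 addr0].
  - move=> n _; split => //; rewrite (@inner_antidiag _ _ _ n).
      rewrite -[RHS](fg0 n); apply: eq_bigr => i _; rewrite /gd /= subnKC ?eqxx//.
      by rewrite -ltnS.
    by move=> ab abn; rewrite /gd ifF//; exact/negbTE.
have Hgg1 := H2B Hg Hg1.
have -> : inner f g = inner f (g - g1) by rewrite innerBr// g10 subr0.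
apply: (@le_trans _ _ (e / (nsq f + 1) * nsq f)).
  apply: inner_small => //.
  rewrite -lee_fin -nsqE//.
  have := HN [set ab | (ab.1 + ab.2 < N)%N] (fun _ => id).
  move=> /ltW; apply: le_trans; rewrite [leRHS]esum_mkcond; apply: le_esum => ab _.
  have -> : (g - g1) ab = g ab - g1 ab by [].
  rewrite g1E; case: ifPn => abN.
    by rewrite subrr Normc.normc0 expr0n/=; case: ifP => _; rewrite // lee_fin normc2_ge0.
  by rewrite subr0 mem_set//=; exact/negP.
rewrite mulrAC ler_pdivrMr// ler_wpM2l ?(ltW e0)//; lra.
Qed.
End Isometry.

(** * The adjoints of the coordinate multiplications *)

Section Adjoint.
Variable R : realType.
Implicit Types (f g h : coefs R).

Lemma normc2_0 : normc2 (0 : R[i]) = 0.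
Proof. by rewrite normc2E /= expr0n addr0. Qed.

(** Exchanging z and w preserves M and inner products, so the facts about R_2 are transported from
    R_1. *)
Definition swap f : coefs R := fun ab => f (ab.2, ab.1).

Lemma swapK f : swap (swap f) = f.
Proof. by apply: funext => -[]. Qed.

Lemma normsq_swap f : normsq (swap f) = normsq f.
Proof.
rewrite /normsq [RHS](@esum_support_image _ _ _ (fun ab => (ab.2, ab.1)))//.
  by move=> [a b] [c d] [-> ->].
by move=> [a b] /(_ (b, a)).
Qed.

Lemma H2_swap f : H2 f -> H2 (swap f).
Proof. by rewrite /H2 /= normsq_swap. Qed.

Lemma inner_swap f g : inner (swap f) (swap g) = inner f g.
Proof.
have E N : inner_partial (swap f) (swap g) N = inner_partial f g N.
  by rewrite /inner_partial exchange_big.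
by rewrite /inner; under eq_fun do rewrite E;
  under [X in Complex _ (limn X)]eq_fun do rewrite E.
Qed.

Lemma mulw_swap f : mulw f = swap (mulz (swap f)).
Proof. by apply: funext => -[a [|b]]. Qed.

Definition shiftz f : coefs R := fun ab => f (ab.1.+1, ab.2).

Lemma normsq_mulz f : normsq (mulz f) = normsq f.
Proof.
rewrite /normsq (@esum_support_image _ _ _ (fun ab : nat * nat => (ab.1.+1, ab.2)))//.
- by apply: eq_esum => -[].
- by move=> [a b] [c d] [-> ->].
- move=> [[|a] b] H /=; first by congr (_%:E); exact: normc2_0.
  by case: (H (a, b)).
Qed.

Lemma H2_mulz f : H2 f -> H2 (mulz f).
Proof. by rewrite /H2 /= normsq_mulz. Qed.

Lemma inner_mulz f g : H2 f -> H2 g -> inner (mulz f) (mulz g) = inner f g.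
Proof.
apply: inner_isometry => [h Hh|h1 h2|x h].
- by split; [exact: H2_mulz|rewrite /nsq normsq_mulz].
- by apply: funext => -[[|a] b] //; exact: esym (addr0 0).
- by apply: funext => -[[|a] b] //=; rewrite mulr0.
Qed.

Lemma H2_shiftz f : H2 f -> H2 (shiftz f).
Proof.
apply: le_lt_trans.
apply: (@esum_comp_le _ _ _ (fun ab : nat * nat => (ab.1.+1, ab.2))).
  by move=> [a b] [c d] [-> ->].
by move=> ab; rewrite lee_fin; exact: normc2_ge0.
Qed.

(** On all of H2 the adjoint of [mulz] is the backward shift: [f0] is the part of f on the axis a =
    0, orthogonal to the range of [mulz]. *)
Lemma inner_mulz_l h f : H2 h -> H2 f -> inner (mulz h) f = inner h (shiftz f).
Proof.
move=> Hh Hf; pose f0 := f - mulz (shiftz f).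
have Hs := H2_shiftz Hf; have Hm := H2_mulz Hs; have Hmh := H2_mulz Hh.
have -> : f = f0 + mulz (shiftz f) by rewrite subrK.
have Hf0 : H2 f0 by exact: H2B.
rewrite innerDr// inner_mulz// (_ : inner _ f0 = 0) ?add0r; last first.
  apply: inner_antidiag_eq0 => // n; rewrite big1// => -[[|i] /= ni] _.
    by rewrite mul0r.
  by rewrite (_ : f0 _ = 0) ?rmorph0 ?mulr0//; exact: subrr.
congr inner; apply: funext => -[a b].
rewrite /shiftz /=; rewrite /f0.
by have -> : (f - mulz (shiftz f) + mulz (shiftz f)) = f by rewrite subrK.
Qed.

Variable k : nat.
Hypothesis k0 : (0 < k)%N.
Let M := @zero_blocks R k.

Lemma zero_blocksB f g : M f -> M g -> M (f - g).
Proof.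
move=> [Hf f0] [Hg g0]; split; first exact: H2B.
by move=> N r; rewrite block_sumB f0 g0 subrr.
Qed.

(** Reversal turns the residue r into N - r, written N + (k - 1) r to stay within the naturals. *)
Lemma block_sum_swap f N r : block_sum k (swap f) N r = block_sum k f N (N + (k - 1) * r)%N.
Proof.
rewrite /block_sum big_nat_rev /= add0n big_nat_cond [RHS]big_nat_cond.
apply: eq_big => i.
  case: (ltnP i N.+1) => //= iN.
  rewrite subSS -(eqn_modDr (i + (k - 1) * r)) addnA subnK -1?ltnS//.
  rewrite (_ : (r + (i + (k - 1) * r))%N = (r * k + i)%N); last by nia.
  by rewrite modnMDl eq_sym.
by move=> /andP[iN _]; rewrite /swap /=; congr (f (_, _)); lia.
Qed.

Lemma zero_blocks_swap f : M f -> M (swap f).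
Proof.
by move=> [Hf f0]; split; [exact: H2_swap|move=> N r; rewrite block_sum_swap f0].
Qed.

Lemma zero_blocks_mulz f : M f -> M (mulz f).
Proof.
move=> [Hf f0]; split; first exact: H2_mulz.
move=> [|N] r; first by rewrite /block_sum big_mkcond big_nat1 /=; case: ifP.
rewrite /block_sum big_mkcond big_nat_recl//= if_same add0r -big_mkcond /=.
(* The residue r - 1, again written without subtraction from r. *)
rewrite -[RHS](f0 N (r + (k - 1))%N); apply: eq_big => // i.
by rewrite -(eqn_modDr (k - 1)) addSnnS (_ : (k - 1).+1 = k) ?modnDr//; lia.
Qed.

(* The block of (a, b) in shiftz f is complete unless a + 1 is a multiple of k,
   in which case only the entry f(0, a + b + 1) is missing: the mean of the block
   is then minus the value below. *)
Definition mean_corr f : coefs R := fun ab =>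
  if (k %| ab.1.+1)%N then f (0%N, (ab.1 + ab.2).+1) / (ab.1.+1 %/ k + ab.2 %/ k)%:R
  else 0.

Definition zadj f : coefs R := shiftz f + mean_corr f.

Lemma mean_corr_antidiag f i n : (i <= n)%N -> mean_corr f (i, (n - i)%N) =
  if (k %| i.+1)%N then f (0%N, n.+1) / (n.+1 %/ k)%:R else 0.
Proof.
move=> ni; rewrite /mean_corr /=; case: ifP => // ki.
by rewrite -divnDl// subnKC// addSn subnKC.
Qed.

Lemma normc2_nat n : normc2 (n%:R : R[i]) = n%:R ^+ 2.
Proof. by rewrite -(rmorph_nat (real_complex R)) normc2C. Qed.

Lemma normc2V (x : R[i]) : normc2 x^-1 = (normc2 x)^-1.
Proof. by rewrite /normc2 Normc.normcV exprVn. Qed.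

(** On the antidiagonal n there are c = floor((n + 1)/k) nonzero positions, each with value f(0, n +
    1)/c. Their squares add up to |f(0, n + 1)|^2 / c. *)
Lemma H2_mean_corr f : H2 f -> H2 (mean_corr f).
Proof.
move=> Hf; apply: le_lt_trans Hf.
rewrite /normsq -/(normc2 _) (@esum_antidiag _ (fun ab => normc2 (mean_corr f ab)));
  last first.
  by move=> ab; exact: normc2_ge0.
apply: le_trans (@esum_comp_le _ _ _ (fun n => (0%N, n.+1)) (fun ab =>
  (normc2 (f ab))%:E) _ _).
- apply: le_esum => n _; rewrite lee_fin.
  under eq_bigr => i _ do rewrite (mean_corr_antidiag f (ltn_ord i : (i <= n)%N)).
  rewrite -(big_mkord xpredT (fun i =>
    normc2 (if (k %| i.+1)%N then f (0%N, n.+1) / (n.+1 %/ k)%:R else 0))).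
  rewrite (eq_bigr (fun i =>
    if (k %| i.+1)%N then normc2 (f (0%N, n.+1) / (n.+1 %/ k)%:R) else 0)); last first.
    by move=> i _; case: ifP => // _; rewrite normc2_0.
  rewrite -big_mkcond sum_dvd_const// normc2M normc2V normc2_nat -[leLHS]mulr_natr.
  case: (n.+1 %/ k)%N => [|c]; first by rewrite mulr0 normc2_ge0.
  rewrite -mulrA ler_piMr ?normc2_ge0// expr2 invfM mulfVK ?pnatr_eq0//.
  by rewrite invf_le1 ?ltr0n// ler1n.
- by move=> ? ? [].
- by move=> ab; rewrite lee_fin normc2_ge0.
Qed.

(** The block of (0, b) has a single entry when b < k. *)
Lemma zero_blocks_axis0 f : M f -> forall b, (b < k)%N -> f (0%N, b) = 0.
Proof.
move=> [_ f0] b bk; rewrite -[RHS](f0 b 0%N) /block_sum [RHS]big_mkcond big_nat_recl//=.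
rewrite eqxx subn0 big1_seq ?addr0// => i; rewrite mem_index_iota => /andP[_ ib].
by rewrite mod0n modn_small//; exact: leq_ltn_trans bk.
Qed.

Lemma zero_blocks_zadj f : M f -> M (zadj f).
Proof.
move=> Mf; have [Hf f0] := Mf; split.
  by apply: H2D; [exact: H2_shiftz|exact: H2_mean_corr].
move=> N r; rewrite /block_sum /zadj big_split /=.
(* Up to the entry lost at a = 0 this is the block sum of f with total N + 1 and residue r + 1; the
   lost entry belongs to that block when k divides r + 1. *)
have -> : \sum_(0 <= i < N.+1 | i == r %[mod k]) shiftz f (i, (N - i)%N) =
   - if (k %| r.+1)%N then f (0%N, N.+1) else 0.
  apply/eqP; rewrite -subr_eq0 opprK addrC; apply/eqP.
  rewrite -[RHS](f0 N.+1 r.+1) /block_sum [RHS]big_mkcond big_nat_recl//=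
    -[in RHS]big_mkcond.
  rewrite subn0 mod0n eq_sym -/(dvdn k r.+1); congr (_ + _).
  by apply: eq_big => // i; rewrite -(eqn_modDr 1) !addn1.
rewrite big_mkcond.
rewrite (eq_big_nat _ _ (F2 := fun i => if (k %| i.+1)%N then
   (if (k %| r.+1)%N then f (0%N, N.+1) / (N.+1 %/ k)%:R else 0) else 0)); last first.
  move=> i iN; rewrite mean_corr_antidiag; last by lia.
  have -> : (i == r %[mod k]) = (i.+1 == r.+1 %[mod k]).
    by rewrite -(eqn_modDr 1) !addn1.
  case: ifP => [ir|]; case: ifP => // ki.
    by rewrite (_ : (k %| r.+1)%N) // /dvdn -(eqP ir).
  move=> ir; rewrite ifF//; apply: contraFF ir => kr.
  by rewrite (eqP ki) (eqP kr).
rewrite -big_mkcond sum_dvd_const//.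
case: ifP => _; last by rewrite mul0rn oppr0 addr0.
(* If N + 1 < k the corrected block is empty, and the lost entry f(0, N + 1) is itself 0. *)
case: (posnP (N.+1 %/ k)) => [E|E].
  by rewrite E mulr0n addr0 zero_blocks_axis0 ?oppr0//; rewrite ltnNge -(divn_gt0 _ k0) E.
by rewrite -[X in _ + X]mulr_natr divfK ?addNr// pnatr_eq0 -lt0n.
Qed.


(** Two candidates for the value chosen by [adj] differ by an element of M orthogonal to M, hence to
    itself. *)
Lemma adj_unique T f g : M g -> (forall h, M h -> inner (T h) f = inner h g) ->
  adj M T f = g.
Proof.
move=> Mg gP; apply: xget_unique => // g' [Mg' g'P].
have Md := zero_blocksB Mg' Mg; have [Hd _] := Md.
have : inner (g' - g) (g' - g) = 0.
  by rewrite innerBr -?gP -?g'P ?subrr//; [case: Mg'|case: Mg].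
rewrite inner_nsq// => -[d0]; apply/eqP; rewrite -subr_eq0; apply/eqP.
by apply: normsq_eq0; rewrite nsqE// d0.
Qed.

(** On each antidiagonal the correction is constant on the block of residue k - 1 and 0 elsewhere,
    so pairing with it produces a block sum of h. Thus [zadj] is the projected backward shift. *)
Lemma inner_mean_corr_eq0 h f : M h -> H2 f -> inner h (mean_corr f) = 0.
Proof.
move=> [Hh h0] Hf; apply: inner_antidiag_eq0 => // [|n]; first exact: H2_mean_corr.
under eq_bigr => i _ do rewrite (mean_corr_antidiag f (ltn_ord i : (i <= n)%N)).
transitivity (block_sum k h n (k - 1) * (f (0%N, n.+1) / (n.+1 %/ k)%:R)^*);
  last by rewrite h0 mul0r.
rewrite /block_sum big_mkord mulr_suml [RHS]big_mkcond; apply: eq_bigr => i _.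
have -> : (i == k - 1 %[mod k]) = (k %| i.+1)%N.
  by rewrite -(eqn_modDr 1) !addn1 (_ : (k - 1).+1 = k) ?modnn//; lia.
by case: ifP => _; rewrite ?rmorph0 ?mulr0.
Qed.

Lemma adj_mulz f : M f -> adj M (@mulz R) f = zadj f.
Proof.
move=> Mf; have [Hf _] := Mf; apply: adj_unique; first exact: zero_blocks_zadj.
move=> h Mh; have [Hh _] := Mh.
rewrite inner_mulz_l// /zadj innerDr ?inner_mean_corr_eq0 ?addr0//; first exact: H2_shiftz.
exact: H2_mean_corr.
Qed.

Lemma adj_mulz_mulz f : M f -> adj M (@mulz R) (mulz f) = f.
Proof.
move=> Mf; have [Hf _] := Mf; apply: adj_unique => // h [Hh _].
exact: inner_mulz.
Qed.

Definition wadj f := swap (zadj (swap f)).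

Lemma zero_blocks_wadj f : M f -> M (wadj f).
Proof. by move=> Mf; apply/zero_blocks_swap/zero_blocks_zadj/zero_blocks_swap. Qed.

Lemma zero_blocks_mulw f : M f -> M (mulw f).
Proof. by move=> Mf; rewrite mulw_swap;
  apply/zero_blocks_swap/zero_blocks_mulz/zero_blocks_swap. Qed.

Lemma adj_mulw f : M f -> adj M (@mulw R) f = wadj f.
Proof.
move=> Mf; apply: adj_unique; first exact: zero_blocks_wadj.
have Msf := zero_blocks_swap Mf; have [Hsf _] := Msf.
move=> h Mh; have Msh := zero_blocks_swap Mh; have [Hsh _] := Msh.
rewrite mulw_swap -(swapK f) inner_swap inner_mulz_l// -[h in RHS]swapK inner_swap swapK.
rewrite /zadj innerDr ?inner_mean_corr_eq0 ?addr0//; first exact: H2_shiftz.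
exact: H2_mean_corr.
Qed.

Lemma adj_mulw_mulw f : M f -> adj M (@mulw R) (mulw f) = f.
Proof.
move=> Mf; apply: adj_unique => // h Mh.
rewrite !mulw_swap inner_swap inner_mulz ?inner_swap//; apply: H2_swap.
  by case: Mh.
by case: Mf.
Qed.

End Adjoint.

(** * An orthonormal basis *)

Section LinSpan.
Variable R : realType.
Implicit Types (f g h : coefs R) (E : set (coefs R)).

Lemma lin_span_mem E e : E e -> lin_span E e.
Proof.
move=> Ee; exists [:: e], (fun=> 1); split; first by move=> e'; rewrite inE => /eqP ->.
by apply: funext => ab; rewrite big_seq1 mul1r.
Qed.

Lemma lin_span0 E : lin_span E 0.
Proof.
exists [::], (fun=> 0); split => //.
by apply: funext => ab; rewrite big_nil.
Qed.

Lemma lin_spanZ E (x : R[i]) f : lin_span E f -> lin_span E (fun ab => x * f ab).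
Proof.
move=> [s [c [sE ->]]]; exists s, (fun e => x * c e); split => //.
by apply: funext => ab; rewrite mulr_sumr; apply: eq_bigr => e _; rewrite mulrA.
Qed.

(** Coefficients in [lin_span] belong to vectors and not to list positions. Hence the union without
    duplicates, and coefficient functions cut off outside their own lists. *)
Lemma lin_spanD E f g : lin_span E f -> lin_span E g -> lin_span E (f + g).
Proof.
move=> /lin_span_uniq[s1 [c1 [u1 E1 ->]]] /lin_span_uniq[s2 [c2 [u2 E2 ->]]].
exists (undup (s1 ++ s2)).
exists (fun e => (if e \in s1 then c1 e else 0) + (if e \in s2 then c2 e else 0)).
split; first by move=> e; rewrite mem_undup mem_cat => /orP[/E1|/E2].
apply: funext => ab; under [RHS]eq_bigr do rewrite mulrDl.
rewrite big_split /=.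
have H (s : seq (coefs R)) (c : coefs R -> R[i]) : uniq s -> {subset s <= s1 ++ s2} ->
    \sum_(e <- s) c e * e ab =
    \sum_(e <- undup (s1 ++ s2)) (if e \in s then c e else 0) * e ab.
  move=> us ss; rewrite [RHS](bigID (mem s)) /= [X in _ = _ + X]big1 ?addr0; last first.
    by move=> e /negbTE ->; rewrite mul0r.
  rewrite [RHS](eq_bigr (fun e => c e * e ab)); last by move=> e ->.
  rewrite -[RHS]big_filter; apply: perm_big; apply: uniq_perm => //.
    by rewrite filter_uniq// undup_uniq.
  move=> e; rewrite mem_filter mem_undup; apply/idP/andP => [es|[]//].
  by split => //; exact: ss.
rewrite -!H// => e es; rewrite mem_cat es ?orbT//.
Qed.

Lemma lin_span_sum E (I : Type) (s : seq I) (F : I -> coefs R) :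
  (forall i, lin_span E (F i)) -> lin_span E (\sum_(i <- s) F i).
Proof. by move=> HF; apply: big_ind => //; [exact: lin_span0|exact: lin_spanD]. Qed.

End LinSpan.

Section Helmert.
Variable R : realType.
Variable k : nat.
Hypothesis k0 : (0 < k)%N.
Let gen := zvar R ^+ k - wvar R ^+ k.
Let M := @zero_blocks R k.

Lemma zero_blocksD f g : M f -> M g -> M (f + g).
Proof.
move=> [Hf f0] [Hg g0]; split; first exact: H2D.
by move=> N r; rewrite /block_sum big_split /= -!/(block_sum _ _ _ _) f0 g0 addr0.
Qed.

Lemma zero_blocksZ (x : R[i]) f : M f -> M (fun ab => x * f ab).
Proof.
move=> [Hf f0]; split; first exact: H2Z.
by move=> N r; rewrite /block_sum -mulr_sumr -/(block_sum _ _ _ _) f0 mulr0.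
Qed.

Lemma zero_blocks_gen_mul q : M (coefs_of_poly (gen * q)).
Proof. by split; [exact: H2_poly|exact: block_sum_gen_mul]. Qed.

(* Helmert's vectors (1, ..., 1, -q, 0, ..., 0) along a block, with q ones. *)
Definition helmert (i N : nat) : coefs R := fun ab =>
  if (ab.1 + ab.2 == N)%N && (ab.1 == i %[mod k]) then
    if (ab.1 < i)%N then 1 else if ab.1 == i then - (i %/ k)%:R else 0
  else 0.

Lemma helmert_lt i N : (i < k)%N -> helmert i N = 0.
Proof.
move=> ik; apply: funext => -[a b]; rewrite /helmert /= divn_small// oppr0 if_same.
case: ifP => // /andP[_]; rewrite (modn_small ik) => /eqP ai; case: ltnP => // a_i.
by move: ai; rewrite modn_small; [lia|exact: ltn_trans ik].
Qed.

(** With q = floor((i + k)/k), adding q at i turns the entry - (q - 1) into 1, and - q appears at i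
    + k. The identity serves in both directions: it puts the vectors in M by induction, and it
    expresses multiples of [gen] through them. *)
Lemma helmert_rec i j : helmert (i + k) (i + k + j) =
  helmert i (i + k + j) + (fun ab => - ((i + k) %/ k)%:R *
    coefs_of_poly (gen * (zvar R ^+ i * wvar R ^+ j)) ab).
Proof.
apply: funext => -[a b].
transitivity (helmert i (i + k + j) (a, b) + - ((i + k) %/ k)%:R *
  coefs_of_poly (gen * (zvar R ^+ i * wvar R ^+ j)) (a, b)); last by [].
rewrite coefs_of_gen_mul !coefs_of_monomial.
have -> : (if (a < k)%N then 0 else ((a - k == i)%N && (b == j))%:R) =
   ((a == i + k)%N && (a + b == i + k + j)%N)%:R :> R[i].
  by case: ltnP => ak; [rewrite [_ && _]negbTE//; lia|congr (_%:R); lia].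
have -> : (if (b < k)%N then 0 else ((a == i)%N && (b - k == j)%N)%:R) =
   ((a == i)%N && (a + b == i + k + j)%N)%:R :> R[i].
  by case: ltnP => ak; [rewrite [_ && _]negbTE//; lia|congr (_%:R); lia].
rewrite /helmert /= modnDr.
case: eqP => abN /=; last by rewrite !andbF subrr mulr0 addr0.
rewrite !andbT divnDr// divnn k0 addn1.
case: eqP => ai; last first.
  rewrite (_ : (a == i + k)%N = false) 1?(_ : (a == i)%N = false).
  - by rewrite subrr mulr0 addr0.
  - by apply/negbTE/eqP => E; apply: ai; rewrite E.
  - by apply/negbTE/eqP => E; apply: ai; rewrite E modnDr.
case: (ltngtP a i) => [lt_ai|lt_ia|->].
- have -> : (a < i + k)%N by lia.
  have -> : (a == i + k)%N = false by lia.
  by rewrite subrr mulr0 addr0.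
- case: (ltngtP a (i + k)%N) => [lt_aik|gt_aik|_].
  + have /eqP := ai; rewrite eqn_mod_dvd ?(ltnW lt_ia)// => /dvdn_leq; lia.
  + by rewrite subrr mulr0 addr0.
  + by rewrite subr0 mulr1 add0r.
- have -> : (i < i + k)%N by lia.
  have -> : (i == i + k)%N = false by lia.
  by rewrite sub0r mulrN1 opprK -natr1 addrA addNr add0r.
Qed.

Lemma zero_blocks_helmert i N : (i <= N)%N -> M (helmert i N).
Proof.
elim/ltn_ind : i => i IH iN; case: (ltnP i k) => ik.
  rewrite helmert_lt//; have := @zero_blocks_gen_mul 0; rewrite mulr0 coefs_of_poly0 //.
have := helmert_rec (i - k) (N - i); rewrite subnK// subnKC// => ->.
by apply: zero_blocksD; [apply: IH; lia|exact/zero_blocksZ/zero_blocks_gen_mul].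
Qed.

(** If both vectors live on the same block, the longer one equals 1 at all positions up to i, so the
    inner product is a block sum of the shorter one. *)
Lemma inner_helmert_lt i N i' N' : (i <= N)%N -> (i' <= N')%N -> (i < i')%N ->
  inner (helmert i N) (helmert i' N') = 0.
Proof.
move=> iN iN' ii'; rewrite (@inner_antidiag _ _ _ N'); last first.
  by move=> ab /negbTE; rewrite /helmert => ->.
case: (eqVneq N N') => [<-|NN']; last first.
  rewrite big1// => a _.
  have aN : (a <= N')%N by rewrite -ltnS.
  rewrite /helmert /= subnKC// [N' == N]eq_sym (negbTE NN') /=.
  by rewrite mul0r.
case: (eqVneq (i %% k)%N (i' %% k)%N) => [ii|nii].
  have [_ /(_ N i)] := zero_blocks_helmert iN;
    rewrite /block_sum big_mkord big_mkcond /= => H0; rewrite -[RHS]H0.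
  apply: eq_bigr => a _; have aN : (a <= N)%N by rewrite -ltnS.
  rewrite /helmert /= subnKC// eqxx /= -ii.
  case: eqP => ai; last by rewrite mul0r.
  case: (ltngtP (a : nat) i) => ai'; rewrite ?mul0r//.
    have -> : (a < i')%N by lia.
    by rewrite rmorph1 mulr1.
  by rewrite ai' ii' rmorph1 mulr1.
rewrite big1// => a _; rewrite /helmert /=; case: (eqVneq (a %% k)%N (i %% k)%N) => ai.
  by rewrite ai (negbTE nii) andbF rmorph0 mulr0.
by rewrite andbF mul0r.
Qed.

(** Every entry v satisfies v^2 = v, except at i, where q^2 = - q + (q^2 + q) with q = floor(i/k);
    and the entries of the block add up to 0. *)
Lemma inner_helmert_eq i N : (i <= N)%N ->
  inner (helmert i N) (helmert i N) = (i %/ k)%:R ^+ 2 + (i %/ k)%:R.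
Proof.
move=> iN; rewrite (@inner_antidiag _ _ _ N); last first.
  by move=> ab /negbTE; rewrite /helmert => ->.
transitivity (\sum_(a < N.+1) ((if (a == i %[mod k]) then
     helmert i N (a : nat, (N - a)%N) else 0)
   + (if a == i :> nat then (i %/ k)%:R ^+ 2 + (i %/ k)%:R else 0))).
  apply: eq_bigr => a _; have aN : (a <= N)%N by rewrite -ltnS.
  rewrite /helmert /= subnKC// eqxx /=.
  case: (ltngtP (a : nat) i) => [ai|ai|->]; rewrite ?eqxx ?addr0.
  - by case: ifP => _; rewrite ?mul0r ?mul1r// rmorph1.
  - by case: ifP => _; rewrite ?mul0r.
  - by rewrite rmorphN rmorph_nat; ring.
rewrite big_split /=; have [_ /(_ N i)] := zero_blocks_helmert iN.
rewrite /block_sum big_mkord big_mkcond /= => ->; rewrite add0r.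
rewrite (bigD1 (inord i))//= inordK// eqxx big1 ?addr0// => a.
by rewrite -val_eqE /= inordK// => /negbTE ->.
Qed.

Definition helmert_scale (i : nat) : R[i] :=
  (Num.sqrt ((i %/ k)%:R ^+ 2 + (i %/ k)%:R))^-1%:C%C.

Definition helmert_basis : set (coefs R) :=
  [set e | exists i N, [/\ (k <= i)%N, (i <= N)%N &
    e = (fun ab => helmert_scale i * helmert i N ab)]].


Lemma helmert_scale_sqr i : (k <= i)%N ->
  helmert_scale i * (helmert_scale i)^* * ((i %/ k)%:R ^+ 2 + (i %/ k)%:R) = 1.
Proof.
move=> ki; have q0 : (0 < i %/ k)%N by rewrite divn_gt0.
rewrite mul_conj_normc2 normc2C exprVn sqr_sqrtr; last by rewrite addr_ge0// sqr_ge0.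
rewrite (_ : _ + _ = ((i %/ k)%:R ^+ 2 + (i %/ k)%:R)%:C%C); last first.
  by rewrite rmorphD rmorphXn rmorph_nat.
rewrite -rmorphM mulVf// gt_eqF// ltr_wpDl ?sqr_ge0// ltr0n//.
Qed.

Lemma inner_helmert_neq i N i' N' : (i <= N)%N -> (i' <= N')%N ->
  (i, N) != (i', N') -> inner (helmert i N) (helmert i' N') = 0.
Proof.
move=> iN iN' neq; have [H _] := zero_blocks_helmert iN;
  have [H' _] := zero_blocks_helmert iN'.
case: (ltngtP i i') => [ii'|ii'|ii'].
- exact: inner_helmert_lt.
- by rewrite (inner_conj H' H) inner_helmert_lt// rmorph0.
- move: neq; rewrite ii' xpair_eqE eqxx /= => NN'.
  rewrite (@inner_antidiag _ _ _ N'); last first.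
    by move=> ab /negbTE; rewrite /helmert => ->.
  rewrite big1// => a _; have aN : (a <= N')%N by rewrite -ltnS.
  by rewrite /helmert /= subnKC// [N' == N]eq_sym (negbTE NN') /= mul0r.
Qed.

Lemma lin_span_helmert i N : (i <= N)%N -> lin_span helmert_basis (helmert i N).
Proof.
move=> iN; case: (ltnP i k) => ik; first by rewrite helmert_lt//; exact: lin_span0.
have He : helmert_basis (fun ab => helmert_scale i * helmert i N ab) by exists i, N.
have := lin_spanZ ((helmert_scale i)^* *
  ((i %/ k)%:R ^+ 2 + (i %/ k)%:R)) (lin_span_mem He).
congr lin_span; apply: funext => ab;
  rewrite -[RHS]mul1r -[X in _ = X * _](helmert_scale_sqr ik).
by rewrite [LHS]mulrA; congr (_ * _); rewrite mulrC mulrA.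
Qed.

Lemma lin_span_gen_mul q : lin_span helmert_basis (coefs_of_poly (gen * q)).
Proof.
have H0 i j : lin_span helmert_basis (coefs_of_poly (gen * (zvar R ^+ i * wvar R ^+ j))).
  have Ei := @lin_span_helmert i (i + k + j) ltac:(lia).
  have Eik := @lin_span_helmert (i + k) (i + k + j) ltac:(lia).
  have := lin_spanZ (- (((i + k) %/ k)%:R)^-1) (lin_spanD Eik (lin_spanZ (- 1) Ei)).
  congr lin_span; apply: funext => ab; rewrite helmert_rec.
  pose c : R[i] := ((i + k) %/ k)%:R;
    pose u := coefs_of_poly (gen * (zvar R ^+ i * wvar R ^+ j)) ab.
  transitivity (- c^-1 * (helmert i (i + k + j) ab + - c * u + -1 *
    helmert i (i + k + j) ab)) => //.
  have c0 : c != 0 by rewrite pnatr_eq0 -lt0n divn_gt0//; lia.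
  rewrite -/u; move: c0; clearbody c u; move: (helmert _ _ ab) => h c0; field.
  exact: c0.
rewrite -(coefK q) poly_def mulr_sumr.
have -> : coefs_of_poly (\sum_(i < size q) gen * (q`_i *: 'X^i)) =
    \sum_(i < size q) coefs_of_poly (gen * (q`_i *: 'X^i)).
  by apply: funext => ab; rewrite fct_sumE coefs_of_poly_sum.
apply: lin_span_sum => i.
rewrite -(coefK q`_i) poly_def scaler_suml mulr_sumr.
have -> : coefs_of_poly (\sum_(j < size q`_i) gen * (q`_i`_j *: 'X^j *: 'X^i)) =
    \sum_(j < size q`_i) coefs_of_poly (gen * (q`_i`_j *: 'X^j *: 'X^i)).
  by apply: funext => ab; rewrite fct_sumE coefs_of_poly_sum.
apply: lin_span_sum => j.
have := lin_spanZ (q`_i`_j) (H0 i j); congr lin_span; apply: funext => ab.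
rewrite -coefs_of_polyZ; congr (coefs_of_poly _ ab).
rewrite scalerAr; congr (_ * _); rewrite /zvar /wvar -rmorphXn mulrC mul_polyC scalerA.
by rewrite -mul_polyC.
Qed.

(** This existence keeps the choice in [HSnormsq] from falling back on [set0], where the sum would
    be 0. *)
Lemma orthonormal_helmert_basis : orthonormal_basis (submodule_of gen) helmert_basis.
Proof.
split.
- by rewrite submodule_genE// => _ [i [N [ki iN ->]]];
    exact/zero_blocksZ/zero_blocks_helmert.
- move=> _ _ [i [N [ki iN ->]]] [i' [N' [ki' iN' ->]]].
  have [H _] := zero_blocks_helmert iN; have [H' _] := zero_blocks_helmert iN'.
  rewrite innerZl ?innerZr//; last exact: H2Z.
  have e1 : inner (fun ab => helmert_scale i * helmert i N ab) (fun ab =>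
    helmert_scale i * helmert i N ab) = 1.
    rewrite innerZl ?innerZr//; last exact: H2Z.
    by rewrite inner_helmert_eq// mulrA helmert_scale_sqr.
  case: (eqVneq (i, N) (i', N')) => [[<- <-]|neq].
    by rewrite eqxx inner_helmert_eq// mulrA helmert_scale_sqr.
  (* Different indices give different functions: otherwise a vector of norm 1 would be orthogonal to
     itself. *)
  rewrite inner_helmert_neq// !mulr0; case: eqP => // ee.
  move: e1; rewrite {2}ee innerZl ?innerZr//; last exact: H2Z.
  by rewrite inner_helmert_neq// !mulr0 => /eqP; rewrite eq_sym oner_eq0.
- move=> f [Hf fA]; split => // e e0; have [_ [q _ <-] fq] := fA _ e0.
  by exists (coefs_of_poly (gen * q)) => //; exact: lin_span_gen_mul.
Qed.

Lemma sum_basis_axis E b : orthonormal_basis M E ->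
  (\esum_(e in E) (normc2 (e (0%N, b)))%:E)%E = (1 - (b %/ k).+1%:R^-1)%:E.
Proof.
move=> EM.
(* m is the size of the block of (0, b), and x is w^b minus its block mean, that is, the projection
   of w^b onto M. *)
pose m : R[i] := (b %/ k).+1%:R.
pose x : coefs R := fun ab => if (ab.1 + ab.2 == b)%N then
  if (k %| ab.1)%N then (ab.1 == 0%N)%:R - m^-1 else 0 else 0.
have x_anti ab : (ab.1 + ab.2 != b)%N -> x ab = 0 by rewrite /x => /negbTE ->.
have xE (f : coefs R) : M f ->
    \sum_(i < b.+1) f (i : nat, (b - i)%N) * (x (i : nat, (b - i)%N))^* = f (0%N, b).
  move=> [_ /(_ b 0%N)]; rewrite /block_sum big_mkord => f0.
  transitivity (\sum_(i < b.+1) (if i == ord0 then f (0%N, b) else 0) -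
     \sum_(i < b.+1) (if i == 0 %[mod k] then f (i : nat, (b - i)%N) else 0) * m^-1).
    rewrite -sumrB; apply: eq_bigr => i _; have ib : (i <= b)%N by rewrite -ltnS.
    rewrite /x /= subnKC// eqxx mod0n -/(dvdn k i) -val_eqE /=.
    case: ifP => ki; last first.
      rewrite ifF ?mul0r ?subr0 ?rmorph0 ?mulr0//.
      by apply: contraFF ki => /eqP ->; exact: dvdn0.
    have mC : (m^-1)^* = m^-1 by rewrite fmorphV rmorph_nat.
    rewrite rmorphB rmorph_nat /= mC mulrBr.
    case: eqP => [->|_]; last by rewrite mulr0.
    by rewrite subn0 mulr1.
  rewrite (bigD1 ord0)//= big1 ?addr0; last by move=> i /negbTE ->.
  by rewrite -mulr_suml -big_mkcond f0 mul0r subr0.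
have Mx : M x.
  split; first by apply: (@H2_finite _ _ b.+1) => ab ab1; apply: x_anti; lia.
  move=> n r; rewrite /block_sum.
  case: (eqVneq n b) => [->|nb]; last first.
    by rewrite big1_seq// => i; rewrite mem_index_iota => /andP[_ ib];
      apply: x_anti => /=; lia.
  rewrite big_mkcond (eq_big_nat _ _ (F2 := fun i => if (k %| r)%N then
     (if i == 0%N then 1 else 0) - (if (k %| i)%N then m^-1 else 0) else 0)); last first.
    move=> i ib; rewrite /x /=; have -> : (i + (b - i) == b)%N by lia.
    have ki0 : ~~ (k %| i)%N -> (i == 0%N) = false by case: i {ib} => //; rewrite dvdn0.
    have [kr|kr] := boolP (k %| r)%N; have [ki|ki] := boolP (k %| i)%N.
    - by rewrite (eqP kr) (eqP ki) eqxx; case: eqP.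
    - by rewrite ki0// subr0; case: ifP.
    - by rewrite ifF//; apply: contraNF kr => /eqP; rewrite /dvdn => <-.
    - by case: ifP.
  case: (k %| r)%N; last by rewrite big1.
  rewrite sumrB big_nat_recl//= big1 ?addr0//.
  rewrite big_nat_recl//= dvdn0 -big_mkcond sum_dvd_const//.
  by rewrite -mulrS -mulr_natr mulVf ?subrr// pnatr_eq0.
have Hx : H2 x by case: Mx.
have := @parseval _ M E x (fun f => @proj1 _ _) EM Mx.
have [EsubM _ _] := EM.
rewrite (@eq_esum _ _ _ _ (fun e => (normc2 (e (0%N, b)))%:E)).
  move=> ->; congr (_%:E); apply: (@complexI R); rewrite -inner_nsq//.
  (* As x lies in M, its squared norm is its own entry at (0, b). *)
  rewrite (@inner_antidiag _ _ _ b)// xE// /x /= add0n eqxx dvdn0.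
  by rewrite rmorphB fmorphV rmorph_nat rmorph1.
move=> e /EsubM Me; have [He _] := Me.
by rewrite (inner_conj He Hx) normc2_conj (@inner_antidiag _ _ _ b)// xE.
Qed.

End Helmert.

(** * The invariants of index 0 and 1 *)

Section SigmaLow.
Variable R : realType.
Variable k : nat.
Hypothesis k0 : (0 < k)%N.
Let gen := zvar R ^+ k - wvar R ^+ k.
Let M := @zero_blocks R k.

(** The nonnegative double sum is exchanged, and the inner sum over the basis is then
    [sum_basis_axis], the same for every basis. *)
Lemma HSnormsq_axis (T : coefs R -> coefs R) (w : nat * nat -> R) (p : nat * nat -> nat) :
  (forall ab, 0 <= w ab) ->
  (forall e ab, M e -> normc2 (T e ab) = w ab * normc2 (e (0%N, p ab))) ->
  HSnormsq M T = (\esum_(ab in [set: nat * nat])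
    (w ab * (1 - (p ab %/ k).+1%:R^-1))%:E)%E.
Proof.
move=> w0 Tw; rewrite /HSnormsq.
have : orthonormal_basis M (xget set0 [set E | orthonormal_basis M E]).
  apply: (@xgetPex _ set0 [set E | orthonormal_basis M E]).
  by exists (@helmert_basis R k); rewrite /M -submodule_genE//;
    exact: orthonormal_helmert_basis.
set E := xget _ _ => EM; have [EsubM _ _] := EM.
rewrite (@eq_esum _ _ _ _ (fun e => \esum_(ab in [set: nat * nat])
    (w ab * normc2 (e (0%N, p ab)))%:E)%E); last first.
  by move=> e /EsubM Me; apply: eq_esum => ab _; rewrite -/(normc2 _) Tw.
rewrite esum_exchange; last by move=> e ab; rewrite lee_fin mulr_ge0// normc2_ge0.
apply: eq_esum => ab _; rewrite EFinM -(sum_basis_axis k0 (p ab) EM) -esumZ//.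
by move=> e; rewrite lee_fin normc2_ge0.
Qed.

(** As R_1^* R_1 is the identity, the commutator is the identity minus R_1 R_1^*. Off the axis a = 0
    the two shifts cancel and only the correction in [zadj] remains. *)
Lemma comm_zadjE e : M e ->
  comm (adj M (@mulz R)) (@mulz R) e =
  fun ab => if ab.1 is a.+1 then - mean_corr k e (a, ab.2) else e ab.
Proof.
move=> Me; rewrite /comm adj_mulz_mulz// adj_mulz//.
apply: funext => -[[|a] b] /=; first exact: subr0.
transitivity (e (a.+1, b) - (e (a.+1, b) + mean_corr k e (a, b))) => //.
by rewrite opprD addrA subrr add0r.
Qed.

Lemma comm_wadjE e : M e ->
  comm (adj M (@mulw R)) (@mulw R) e =
  fun ab => if ab.2 is b.+1 then - mean_corr k (swap e) (b, ab.1) else e ab.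
Proof.
move=> Me; rewrite /comm adj_mulw_mulw// adj_mulw//.
apply: funext => -[a [|b]] /=; first exact: subr0.
transitivity (e (a, b.+1) - (e (a, b.+1) + mean_corr k (swap e) (b, a))) => //.
by rewrite opprD addrA subrr add0r.
Qed.

Lemma zero_blocks_comm_z e : M e -> M (comm (adj M (@mulz R)) (@mulz R) e).
Proof.
move=> Me; rewrite /comm adj_mulz_mulz// adj_mulz//.
exact/zero_blocksB/zero_blocks_mulz/zero_blocks_zadj.
Qed.

(** Weights in the rescaled exponents a/k and b/k. An entry with b > 0 is divided by a block count
    in both commutators, one with b = 0 only once; hence the exponents 4 and 2. The last factor is
    [sum_basis_axis]. *)
Definition weight0 (ab : nat * nat) : R :=
  (if ab.2 == 0%N then (ab.1 + ab.2)%:R^-1 ^+ 2 else (ab.1 + ab.2)%:R^-1 ^+ 4) *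
  (1 - (ab.1 + ab.2).+1%:R^-1).

(** One entry contributes 1/n^2 and n entries 1/n^4; the resulting factor 1 + 1/n cancels against 1
    - 1/(n + 1). For n = 0 both sides are 0, the inverse of 0 being 0. *)
Lemma sum_weight0 (n : nat) :
  \sum_(i < n.+1) weight0 (i : nat, (n - i)%N) = n%:R^-1 ^+ 2.
Proof.
rewrite /weight0 /= big_ord_recr /= subnn addn0 eqxx.
rewrite (eq_bigr (fun=> n%:R^-1 ^+ 4 * (1 - n.+1%:R^-1))); last first.
  move=> i _; have := ltn_ord i => ni; rewrite subnKC ?ifF//; lia.
rewrite sumr_const card_ord -[X in X + _]mulr_natr.
case: n => [|n]; first by rewrite invr0 !expr0n /= !mul0r add0r.
have n1 : n.+1%:R != 0 :> R by rewrite pnatr_eq0.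
have n2 : n.+1%:R + 1 != 0 :> R by rewrite natr1 pnatr_eq0.
rewrite -(natr1 n.+1); move: n1 n2; move: n.+1%:R => x x0 x1; field.
by rewrite x0 x1.
Qed.

Lemma Sigma0E : Sigma 0 gen = (\sum_(0 <= n <oo) (n%:R^-1 ^+ 2)%:E)%E.
Proof.
rewrite /= /Sigma0 submodule_genE//.
pose w (ab : nat * nat) : R := if (k %| ab.1)%N && (k %| ab.2)%N then
  (if ab.2 == 0%N then (ab.1 %/ k + ab.2 %/ k)%:R^-1 ^+ 2
  else (ab.1 %/ k + ab.2 %/ k)%:R^-1 ^+ 4) else 0.
have w0 ab : 0 <= w ab.
  by rewrite /w; do 2?case: ifP => // _; rewrite exprn_ge0// invr_ge0.
rewrite (@HSnormsq_axis _ w (fun ab => ab.1 + ab.2)%N)//; last first.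
  move=> e [a b] Me; rewrite comm_wadjE; last exact: zero_blocks_comm_z.
  rewrite comm_zadjE// /w /= /mean_corr /=.
  case: b => [|b] /=; rewrite ?dvdn0 ?andbT ?div0n ?addn0.
    (* At the origin the operator returns e(0, 0), which is 0 on M. *)
    case: a => [|a]; first by rewrite (zero_blocks_axis0 Me)// normc2_0 mulr0.
    rewrite normc2N; case: ifP => _; last by rewrite normc2_0 mul0r.
    by rewrite !addn0 normc2M normc2V normc2_nat exprVn mulrC.
  rewrite normc2N.
  case kb : (k %| b.+1)%N; rewrite ?andbF ?normc2_0 ?mul0r// andbT.
  rewrite /swap /= div0n addn0.
  have -> : (k %| (b + a).+1)%N = (k %| a)%N by rewrite -addSn dvdn_addr.
  case ka : (k %| a)%N; last by rewrite oppr0 mul0r normc2_0 mul0r.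
  rewrite addn0 mulNr normc2N !normc2M !normc2V !normc2_nat.
  have -> : ((b + a).+1 %/ k)%N = (a %/ k + b.+1 %/ k)%N by rewrite -addSn divnDl// addnC.
  rewrite (addnC (b.+1 %/ k)%N) (_ : (b + a).+1 = (a + b.+1)%N);
    last by rewrite addnC addnS.
  by rewrite -!exprVn -mulrA -exprD mulrC.
rewrite (@esum_support_image _ _ _ (fun ab : nat * nat => (k * ab.1, k * ab.2)%N));
  last 2 first.
- by move=> [a b] [c d] /= [] /eqP + /eqP; rewrite !eqn_pmul2l// => /eqP -> /eqP ->.
- move=> [a b] H; rewrite /w /=; case: ifP => [/andP[/dvdnP[c ac] /dvdnP[d bd]]|];
    last by rewrite mul0r.
  by case: (H (c, d)); rewrite ac bd; congr pair; exact: mulnC.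
rewrite (@eq_esum _ _ _ _ (fun ab => (weight0 ab)%:E)); last first.
  move=> [a b] _; rewrite /weight0 /w /= !dvdn_mulr//= !mulKn// -mulnDr mulKn//.
  by rewrite muln_eq0 -[k == 0%N]negbK -lt0n k0.
rewrite esum_antidiag; last first.
  move=> ab; apply: mulr_ge0; first by case: ifP => _; rewrite exprn_ge0// invr_ge0.
  by rewrite subr_ge0 invf_le1 ?ltr0n// ler1n.
rewrite nneseries_esumT; last by move=> n; rewrite lee_fin exprn_ge0// invr_ge0.
by apply: eq_esum => n _ /=; rewrite sum_weight0.
Qed.


Definition weight1 (ab : nat * nat) : R :=
  (if ab.2 is b.+1 then (((ab.1 + b.+1).+1)%:R^-1 - (ab.1 + b.+1)%:R^-1) ^+ 2
   else (ab.1.+1)%:R^-1 ^+ 2) * (1 - (ab.1 + ab.2).+1%:R^-1).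

Lemma sum_weight1 (n : nat) :
  \sum_(i < n.+1) weight1 (i : nat, (n - i)%N) =
  if n is m.+1 then n.+1%:R^-1 ^+ 2 else 0.
Proof.
rewrite /weight1 /= big_ord_recr /= subnn addn0.
rewrite (eq_bigr (fun=> (n.+1%:R^-1 - n%:R^-1) ^+ 2 * (1 - n.+1%:R^-1))); last first.
  move=> i _; have ni := ltn_ord i.
  have [m mE] : exists m, (n - i)%N = m.+1 by exists (n - i).-1; lia.
  by rewrite mE (_ : (i + m.+1)%N = n) //; lia.
rewrite sumr_const card_ord -[X in X + _]mulr_natr.
case: n => [|n]; first by rewrite mulr0 add0r invr1 subrr mulr0.
have n1 : n.+1%:R != 0 :> R by rewrite pnatr_eq0.
have n2 : n.+1%:R + 1 != 0 :> R by rewrite natr1 pnatr_eq0.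
rewrite -(natr1 n.+1); move: n1 n2; move: n.+1%:R => x x0 x1; field.
by rewrite x0 x1.
Qed.

(** [shiftz] commutes with [mulw], so the commutator is a difference of two corrections, both
    multiples of the same axis coefficient. For b > 0 their block counts differ only when k divides
    b; for b = 0 the second correction is absent. *)
Lemma Sigma1E : Sigma 1 gen = (\sum_(0 <= n <oo) (n.+2%:R^-1 ^+ 2)%:E)%E.
Proof.
rewrite /= /Sigma1 submodule_genE//.
pose w (ab : nat * nat) : R := if (k %| ab.1.+1)%N then
  (if ab.2 is b.+1 then ((ab.1.+1 %/ k + b.+1 %/ k)%:R^-1 -
    (ab.1.+1 %/ k + b %/ k)%:R^-1) ^+ 2
  else (ab.1.+1 %/ k)%:R^-1 ^+ 2) else 0.
have w0 ab : 0 <= w ab.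
  by rewrite /w; case: ifP => // _; case: ab.2 => [|b]; rewrite sqr_ge0.
rewrite (@HSnormsq_axis _ w (fun ab => ab.1 + ab.2)%N)//; last first.
  move=> e [a b] Me; rewrite /comm (adj_mulz k0 (zero_blocks_mulw k0 Me)) (adj_mulz k0 Me).
  case: b => [|b].
    rewrite (_ : (zadj k (mulw e) - mulw (zadj k e)) (a, 0%N) =
        mean_corr k (mulw e) (a, 0%N)); last first.
      transitivity (0 + mean_corr k (mulw e) (a, 0%N) - 0) => //.
      by rewrite subr0 add0r.
    rewrite /mean_corr /w /=; case: ifP => _; last by rewrite normc2_0 mul0r.
    by rewrite div0n addn0 normc2M normc2V normc2_nat exprVn mulrC addn0.
  rewrite (_ : (zadj k (mulw e) - mulw (zadj k e)) (a, b.+1) =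
      mean_corr k (mulw e) (a, b.+1) - mean_corr k e (a, b)); last first.
    transitivity (e (a.+1, b) + mean_corr k (mulw e) (a, b.+1) -
        (e (a.+1, b) + mean_corr k e (a, b))) => //.
    by rewrite opprD addrA [e _ + _]addrC addrK.
  rewrite /mean_corr /w /=; case: ifP => _; last by rewrite subrr normc2_0 mul0r.
  rewrite addnS -mulrBr normc2M mulrC; congr (_ * _).
  rewrite -!(rmorph_nat (real_complex R)) -!fmorphV -rmorphB /= normc2C.
  by [].
rewrite (@esum_support_image _ _ _ (fun ab : nat * nat =>
  (k * ab.1 + (k - 1), k * ab.2)%N)); last 2 first.
- move=> [a b] [c d] /= [] /eqP + /eqP.
  by rewrite eqn_add2r !eqn_pmul2l// => /eqP -> /eqP ->.
- move=> [a b] H; rewrite /w /=; case: ifP => [/dvdnP[c ac]|]; last by rewrite mul0r.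
  have [kb|kb] := boolP (k %| b)%N.
    have /dvdnP[d bd] := kb.
    case: c ac => [//|c] ac; case: (H (c, d)) => /=; congr pair; last by rewrite bd mulnC.
    by rewrite mulSn mulnC in ac; lia.
  case: b kb {H} => [|b kb]; first by rewrite dvdn0.
  by rewrite (divnS b k0) (negbTE kb) subrr expr0n /= mul0r.
rewrite (@eq_esum _ _ _ _ (fun ab => (weight1 ab)%:E)); last first.
  move=> [a b] _; rewrite /weight1 /w /=.
  have -> : (k * a + (k - 1)).+1 = (k * a.+1)%N by rewrite mulnS; lia.
  rewrite dvdn_mulr// mulKn//.
  have -> : ((k * a + (k - 1) + k * b) %/ k)%N = (a + b)%N.
    rewrite addnAC -mulnDr mulnC divnMDl// divn_small ?addn0//; lia.
  case: b => [|b]; first by rewrite muln0.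
  have F1 : (k * b.+1)%N = (k * b + (k - 1)).+1 by rewrite mulnS; lia.
  have F2 : ((k * b + (k - 1)) %/ k)%N = b.
    by rewrite mulnC divnMDl// divn_small ?addn0//; lia.
  have F3 : ((k * b + (k - 1)).+1 %/ k)%N = b.+1 by rewrite -F1 mulKn.
  by rewrite F1 F2 F3 addSn addSnnS.
rewrite esum_antidiag; last first.
  move=> [a b]; apply: mulr_ge0; first by case: b => [|b]; rewrite sqr_ge0.
  by rewrite subr_ge0 invf_le1 ?ltr0n// ler1n.
rewrite nneseries_esumT; last by move=> n; rewrite lee_fin sqr_ge0.
rewrite (@esum_support_image _ _ _ succn) //; last 2 first.
- by move=> m n [].
- by move=> [|n] H; [rewrite sum_weight1|case: (H n)].
by apply: eq_esum => n _ /=; rewrite sum_weight1.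
Qed.

End SigmaLow.

(** * The cofactors of the Toeplitz matrices *)

Section SigmaHigh.
Variable R : realType.
Variable k : nat.
Hypothesis k0 : (0 < k)%N.
Let gen := zvar R ^+ k - wvar R ^+ k.

Lemma inner_monomial (f : coefs R) i j :
  inner f (coefs_of_poly (zvar R ^+ i * wvar R ^+ j)) = f (i, j).
Proof.
rewrite (@inner_antidiag _ _ _ (i + j)%N); last first.
  move=> [a b] /= abn; rewrite coefs_of_monomial.
  by have -> : (a == i) && (b == j) = false by lia.
have ij : (i < (i + j).+1)%N by lia.
rewrite (bigD1 (Ordinal ij))//= big1; last first.
  move=> a; rewrite -val_eqE /= => /negbTE ai.
  by rewrite coefs_of_monomial ai rmorph0 mulr0.
by rewrite addKn coefs_of_monomial !eqxx rmorph1 mulr1 addr0.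
Qed.

Lemma inner_gen_monomial (f : coefs R) i j : H2 f ->
  inner f (coefs_of_poly (gen * (zvar R ^+ i * wvar R ^+ j))) =
  f ((i + k)%N, j) - f (i, (j + k)%N).
Proof.
move=> Hf; have -> : gen * (zvar R ^+ i * wvar R ^+ j) =
    zvar R ^+ (i + k) * wvar R ^+ j - zvar R ^+ i * wvar R ^+ (j + k).
  by rewrite !exprD /gen; ring.
by rewrite coefs_of_polyB innerBr ?inner_monomial//; exact: H2_poly.
Qed.

Lemma coefs_of_gen_monomial i j a b :
  coefs_of_poly (gen * (zvar R ^+ i * wvar R ^+ j)) (a, b) =
  ((a == i + k) && (b == j))%N%:R - ((a == i) && (b == j + k))%N%:R.
Proof.
have -> : gen * (zvar R ^+ i * wvar R ^+ j) =
    zvar R ^+ (i + k) * wvar R ^+ j - zvar R ^+ i * wvar R ^+ (j + k).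
  by rewrite !exprD /gen; ring.
rewrite coefs_of_polyB.
transitivity (coefs_of_poly (zvar R ^+ (i + k) * wvar R ^+ j) (a, b) -
  coefs_of_poly (zvar R ^+ i * wvar R ^+ (j + k)) (a, b)) => //.
by rewrite !coefs_of_monomial.
Qed.

Lemma polyA_E n (i l : 'I_n.+1) : polyA gen n i l =
  (i == l :> nat)%:R *+ 2 - ((i : nat) == (l + k)%N)%:R - ((l : nat) == (i + k)%N)%:R.
Proof.
rewrite /polyA mxE -!mulrA inner_gen_monomial; last exact: H2_poly.
rewrite !coefs_of_gen_monomial.
have iN := ltn_ord i; have lN := ltn_ord l.
have -> : (i + k == l + k)%N && (n - i == n - l)%N = (i == l :> nat) by lia.
have -> : (i + k == l)%N && (n - i == n - l + k)%N = ((l : nat) == (i + k)%N) by lia.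
have -> : ((i : nat) == (l + k)%N) && (n - i + k == n - l)%N =
  ((i : nat) == (l + k)%N) by lia.
have -> : (i == l :> nat) && (n - i + k == n - l + k)%N = (i == l :> nat) by lia.
rewrite mulr2n; ring.
Qed.

(* The solution c of A^n c = (floor(n/k) + 2) e_0. *)
Definition cramer_vec (n l : nat) : R[i] :=
  if (k %| l)%N then ((n %/ k).+1 - l %/ k)%N%:R else 0.

Definition phi_shape (n : nat) : coefs R := fun ab =>
  if (ab.1 + ab.2 == n + k)%N && (k %| ab.1)%N then
    if ab.1 == 0%N then - (n %/ k).+1%:R else 1 else 0.

(** Truncated subtraction extends c by 0 past n, so the end of the block needs no separate
    formula. *)
Lemma cramer_vec_large n l : (n < l)%N -> cramer_vec n l = 0.
Proof.
move=> nl; rewrite /cramer_vec; case: ifP => // /dvdnP[t lt]; rewrite lt mulnK//.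
have -> : ((n %/ k).+1 - t = 0)%N; last by [].
apply/eqP; rewrite subn_eq0 ltn_divLR//; lia.
Qed.

(** Along the block the sum telescopes: the entry at a is c_(a-k) - c_a, which is 1 at positive
    multiples of k and - c_0 at a = 0. *)
Lemma sum_cramer_vec n ab :
  \sum_(l < n.+1) cramer_vec n l *
    coefs_of_poly (gen * (zvar R ^+ l * wvar R ^+ (n - l))) ab =
  phi_shape n ab.
Proof.
case: ab => a b; under eq_bigr do rewrite coefs_of_gen_monomial.
rewrite /phi_shape /=; case: (eqVneq (a + b)%N (n + k)%N) => [abn|abn] /=; last first.
  rewrite big1// => l _; have lN := ltn_ord l.
  have -> : (a == l + k)%N && (b == n - l)%N = false by lia.
  have -> : (a == l)%N && (b == n - l + k)%N = false by lia.
  by rewrite subrr mulr0.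
transitivity ((if (k <= a)%N then cramer_vec n (a - k) else 0) - cramer_vec n a).
  transitivity (\sum_(l < n.+1) (if (a == l + k)%N then cramer_vec n l else 0) -
     \sum_(l < n.+1) (if (a == l)%N then cramer_vec n l else 0)).
    rewrite -sumrB; apply: eq_bigr => l _; have lN := ltn_ord l.
    have -> : (a == l + k)%N && (b == n - l)%N = (a == l + k)%N by lia.
    have -> : (a == l)%N && (b == n - l + k)%N = (a == l)%N by lia.
    by rewrite mulrBr; do 2 case: (_ == _); rewrite ?mulr1 ?mulr0.
  congr (_ - _).
    case: leqP => ka; last by rewrite big1// => l _; rewrite ifF//; lia.
    have akn : (a - k < n.+1)%N by lia.
    rewrite (bigD1 (Ordinal akn))//= subnK// eqxx big1 ?addr0// => l.
    by rewrite -val_eqE /= => lak; rewrite ifF//; lia.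
  case: (ltnP n a) => na.
    by rewrite cramer_vec_large// big1// => l _; have lN := ltn_ord l; rewrite ifF//; lia.
  have an1 : (a < n.+1)%N by lia.
  rewrite (bigD1 (Ordinal an1))//= eqxx big1 ?addr0// => l.
  by rewrite -val_eqE /= => la; rewrite ifF//; lia.
case: (posnP a) => [->|a0];
  first by rewrite leqNgt k0 /= /cramer_vec dvdn0 div0n subn0 add0r.
rewrite /cramer_vec; have [ka|ka] := boolP (k %| a)%N; last first.
  rewrite subr0; case: leqP => // ka'; rewrite ifF//.
  by rewrite dvdn_subl// (negbTE ka).
have /dvdnP[t at_] := ka.
have t0 : (0 < t)%N by case: t at_ a0 => //; lia.
have lek : (k <= a)%N by rewrite at_; nia.
have akt : ((a - k) %/ k)%N = (t - 1)%N by rewrite at_ -{2}(mul1n k) -mulnBl mulnK.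
have a_t : (a %/ k)%N = t by rewrite at_ mulnK.
rewrite lek dvdn_subl// ka akt a_t.
(* This makes the truncated subtractions in [cramer_vec] exact. *)
have tn : (t <= (n %/ k).+1)%N.
  have : (t * k <= n + k)%N by lia.
  by rewrite -leq_divRL// divnDr// divnn k0 addn1.
move: (n %/ k)%N tn => d tn; rewrite -natrB; last by lia.
by rewrite [X in X%:R](_ : _ = 1%N)//; lia.
Qed.

(** Pairing with [gen] times a monomial takes the difference of neighbouring block entries. In (-d,
    1, ..., 1) with d = floor(n/k) + 1 only the first difference, 1 + d, is nonzero. *)
Lemma polyA_cramer_vec n (i : 'I_n.+1) :
  \sum_(l < n.+1) polyA gen n i l * cramer_vec n l =
  if i == ord0 then (n %/ k).+2%:R else 0.
Proof.
transitivity (phi_shape n ((i + k)%N, (n - i)%N) - phi_shape n (i : nat, (n - i + k)%N)).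
  rewrite -!sum_cramer_vec -sumrB; apply: eq_bigr => l _.
  rewrite /polyA mxE -!mulrA inner_gen_monomial; last exact: H2_poly.
  by rewrite mulrC mulrBr.
have iN := ltn_ord i.
rewrite /phi_shape /= -val_eqE /=.
have -> : (i + k + (n - i) == n + k)%N by lia.
have -> : (i + (n - i + k) == n + k)%N by lia.
have -> : (i + k == 0)%N = false by lia.
rewrite /= dvdn_addl//; case: eqP => [->|_].
  by rewrite dvdn0 opprK -[in RHS]natr1 addrC.
by rewrite subrr.
Qed.


(** Reversing the order of both rows and columns fixes A^n. *)
Lemma polyA_cramer_vec_rev n (i : 'I_n.+1) :
  \sum_(l < n.+1) polyA gen n i l * cramer_vec n (n - l) =
  if i == ord_max then (n %/ k).+2%:R else 0.
Proof.
rewrite (reindex_inj rev_ord_inj) /=.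
have -> : (i == ord_max) = (rev_ord i == ord0).
  by rewrite -!val_eqE /= subSS; have := ltn_ord i; lia.
rewrite -polyA_cramer_vec; apply: eq_bigr => l _.
have iN := ltn_ord i; have lN := ltn_ord l; congr (_ * _); last by congr cramer_vec; lia.
rewrite !polyA_E /=.
have -> : ((i : nat) == n.+1 - l.+1)%N = (n.+1 - i.+1 == l)%N by lia.
have -> : ((i : nat) == n.+1 - l.+1 + k)%N = ((l : nat) == n.+1 - i.+1 + k)%N by lia.
have -> : (n.+1 - l.+1 == i + k)%N = (n.+1 - i.+1 == l + k)%N by lia.
by rewrite -!addrA [- _ - _]addrC.
Qed.

(** Apply the adjugate to A c = g e_(i0). The determinant stays as a factor, since its nonvanishing
    is deduced from this identity afterwards. *)
Lemma cofactor_of_solution n (A : 'M[R[i]]_n.+1) (c : 'I_n.+1 -> R[i]) (i0 : 'I_n.+1) g :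
  (forall i, \sum_l A i l * c l = if i == i0 then g else 0) ->
  forall l, \det A * c l = g * cofactor A i0 l.
Proof.
move=> Ac l; have := congr1 (fun B => (B *m \col_l c l) l ord0) (mul_adj_mx A).
rewrite mul_scalar_mx !mxE => <-.
have Acol : A *m (\col_l c l) = g *: delta_mx i0 ord0.
  apply/matrixP => i j; rewrite !mxE ord1 eqxx andbT.
  under eq_bigr do rewrite mxE; rewrite Ac.
  by case: eqP; rewrite ?mulr1 ?mulr0.
transitivity ((\adj A *m (A *m \col_l c l)) l ord0); first by rewrite mulmxA mxE.
rewrite Acol -scalemxAr mxE; congr (_ * _).
rewrite mxE (bigD1 i0)//= !mxE !eqxx mulr1 big1 ?addr0// => j /negbTE ji.
by rewrite !mxE ji mulr0.
Qed.

(** Deleting the first row and column of the Toeplitz matrix leaves the one of the previous size. *)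
Lemma cofactor_polyA00 n : cofactor (polyA gen n) ord0 ord0 = polyD gen n.
Proof.
rewrite /cofactor addn0 expr0 mul1r.
case: n => [|n] /=; first by rewrite det_mx00.
congr (\det _); apply/matrixP => i l.
by rewrite !mxE -!/(polyA gen _ _ _); have := polyA_E i l;
  have := @polyA_E n.+1 (lift ord0 i) (lift ord0 l);
    rewrite !mxE /= /bump /= !add1n !addSn !eqSS => -> ->.
Qed.

(** Cramer's rule at l = 0, where c_0 = floor(n/k) + 1. By induction it yields D_n != 0. *)
Lemma polyD_rec n : (n %/ k).+2%:R * polyD gen n = (n %/ k).+1%:R * polyD gen n.+1.
Proof.
have := cofactor_of_solution (@polyA_cramer_vec n) ord0.
by rewrite cofactor_polyA00 /cramer_vec /= dvdn0 div0n subn0 mulrC => <-.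
Qed.

Lemma polyD_neq0 n : polyD gen n != 0.
Proof.
elim: n => [|n IH]; first exact: oner_neq0.
apply: contraNneq IH => D0; have := polyD_rec n; rewrite D0 mulr0 => /eqP.
by rewrite mulf_eq0 pnatr_eq0.
Qed.

(** The cofactors are D_(n+1) c_l / (d + 1) with d = floor(n/k) + 1; this is the factor in front of
    c_l. *)
Definition phi_scale n : R[i] :=
  (sqrtC (polyD gen n * polyD gen n.+1))^-1 * polyD gen n.+1 / (n %/ k).+2%:R.

(** Passing to the square removes the branch of [sqrtC] and leaves (D_(n+1)/D_n) / (d + 1)^2, where
    D_(n+1)/D_n = (d + 1)/d. *)
Lemma normc2_phi_scale n : normc2 (phi_scale n) = ((n %/ k).+1%:R * (n %/ k).+2%:R)^-1.
Proof.
have -> : normc2 (phi_scale n) = Normc.normc (phi_scale n ^+ 2) by rewrite /normc2;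
  move: (phi_scale n) => x; rewrite !expr2 Normc.normcM.
have -> : phi_scale n ^+ 2 = (((n %/ k).+1%:R * (n %/ k).+2%:R)^-1)%:C%C.
  rewrite /phi_scale !exprMn exprVn sqrtCK fmorphV rmorphM !rmorph_nat.
  have := polyD_rec n; have := polyD_neq0 n; have := polyD_neq0 n.+1.
  have : (n %/ k).+1%:R != 0 :> R[i] by rewrite pnatr_eq0.
  have : (n %/ k).+2%:R != 0 :> R[i] by rewrite pnatr_eq0.
  move: (n %/ k).+2%:R (n %/ k).+1%:R (polyD _ n) (polyD _ n.+1) => g d x y g0 d0 y0 x0 E.
  have -> : x = d * y / g by rewrite -E mulrAC mulfV ?mul1r.
  by field; rewrite g0 d0 y0.
by rewrite /= expr0n addr0 sqrtr_sqr ger0_norm// invr_ge0 mulr_ge0.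
Qed.

Lemma coefs_row_comb n (i : 'I_n.+1) (c : nat -> R[i]) ab :
  (forall l : 'I_n.+1, \det (polyA gen n) * c l =
     (n %/ k).+2%:R * cofactor (polyA gen n) i l) ->
  coefs_of_poly (row_comb gen i) ab = phi_scale n *
    \sum_(l < n.+1) c l * coefs_of_poly (gen * (zvar R ^+ l * wvar R ^+ (n - l))) ab.
Proof.
move=> Hc; rewrite /row_comb coefs_of_polyZ coefs_of_poly_sum /phi_scale -!mulrA;
  congr (_ * _).
rewrite !mulr_sumr; apply: eq_bigr => l _; rewrite coefs_of_polyZ -(mulrA gen).
have g0 : (n %/ k).+2%:R != 0 :> R[i] by rewrite pnatr_eq0.
have -> : cofactor (polyA gen n) i l = \det (polyA gen n) * c l / (n %/ k).+2%:R.
  by rewrite Hc mulrAC mulfV// mul1r.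
by rewrite !mulrA [X in X * _ = _]mulrAC.
Qed.

Lemma coefs_phi n ab : coefs_of_poly (phi gen n) ab = phi_scale n * phi_shape n ab.
Proof.
rewrite /phi (@coefs_row_comb n ord0 (cramer_vec n)) ?sum_cramer_vec//.
exact: (cofactor_of_solution (@polyA_cramer_vec n)).
Qed.

(** Exchanging z and w changes the sign of z^k - w^k, hence the minus sign. *)
Lemma coefs_psi n a b :
  coefs_of_poly (psi gen n) (a, b) = - (phi_scale n * phi_shape n (b, a)).
Proof.
rewrite /psi (@coefs_row_comb n ord_max (fun l => cramer_vec n (n - l))); last first.
  exact: (cofactor_of_solution (@polyA_cramer_vec_rev n)).
rewrite -mulrN; congr (_ * _); rewrite -sum_cramer_vec (reindex_inj rev_ord_inj) /= -sumrN.
apply: eq_bigr => l _; rewrite -mulrN !coefs_of_gen_monomial opprB; have lN := ltn_ord l.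
rewrite subSS subKn; last by lia.
congr (_ * (_ - _)); congr (_%:R); lia.
Qed.

End SigmaHigh.

(** * The invariants of higher index *)

Section SigmaSeries.
Variable R : realType.

Lemma sum_multiples (V : nmodType) (G : nat -> V) k L : (0 < k)%N ->
  \sum_(0 <= i < (k * L).+1) (if (k %| i)%N then G (i %/ k)%N else 0) =
  \sum_(0 <= t < L.+1) G t.
Proof.
move=> k0; elim: L => [|L IH].
  by rewrite muln0 !big_nat1 dvdn0 div0n.
rewrite [RHS]big_nat_recr//= -IH.
rewrite (@big_cat_nat _ _ _ (k * L).+1)//=; last by rewrite mulnS; lia.
congr (_ + _); rewrite big_nat_recr /=; last by rewrite mulnS; lia.
rewrite dvdn_mulr// mulKn// big1_seq ?add0r// => i.
rewrite mem_index_iota => /andP[_ /andP[i1 i2]]; rewrite ifF//.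
apply/negP => /dvdnP[t it]; move: i1 i2; rewrite it mulnC mulnS.
rewrite ltn_pmul2r// => Lt; have : (k * L.+1 <= k * t)%N by rewrite leq_pmul2l.
by rewrite mulnS [(k * t)%N]mulnC; lia.
Qed.

Lemma sum_interval (m L : nat) : (0 < m)%N ->
  \sum_(0 <= t < L.+1) ((m <= t) && (m <= L - t))%N%:R = (L.+1 - m.*2)%:R :> R.
Proof.
move=> m0; rewrite -natr_sum; congr (_%:R).
case: (leqP m.*2 L) => mL; last first.
  rewrite big1_seq; first by lia.
  by move=> t _; have -> : ((m <= t) && (m <= L - t))%N = false by lia.
rewrite (@big_cat_nat _ _ _ m)//=; last by lia.
rewrite (@big_cat_nat _ _ _ (L.+1 - m)%N _ L.+1)//=; try lia.
rewrite big1_seq; last by move=> t; rewrite mem_index_iota => tt;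
  have -> : ((m <= t) && (m <= L - t))%N = false by lia.
rewrite [X in (_ + (_ + X))%N]big1_seq; last by move=> t; rewrite mem_index_iota => tt;
  have -> : ((m <= t) && (m <= L - t))%N = false by lia.
rewrite (eq_big_nat _ _ (F2 := fun=> 1%N)); last first.
  by move=> t tt; have -> : ((m <= t) && (m <= L - t))%N by lia.
by rewrite sum_nat_const_nat muln1; lia.
Qed.

Variable k : nat.
Hypothesis k0 : (0 < k)%N.
Let gen := zvar R ^+ k - wvar R ^+ k.

(** Put N = n + k + j and m = ceil(j/k). Both divisibilities force N = k L, and then i = k t with m
    <= t <= L - m. The count L + 1 - 2m is rewritten by floor(n/k) = L - 1 - m, as n = k (L - 1 - m)
    + (k m - j) with remainder below k. *)
Lemma sum_phi_shape_overlap n j : (0 < j)%N ->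
  \sum_(0 <= i < (n + k + j).+1) (((k %| i) && (k %| n + k + j - i)) &&
    ((j <= i) && (j <= n + k + j - i)))%N%:R =
  (if (k %| n + j)%N then ((n %/ k).+2 - (j + (k - 1)) %/ k)%N%:R else 0) :> R.
Proof.
move=> j0; have kN : (k %| n + k + j)%N = (k %| n + j)%N by rewrite addnAC dvdn_addl.
case: ifP => knj; last first.
  rewrite big1_seq// => i; rewrite mem_index_iota => ii.
  have [ki|//] := boolP (k %| i)%N; have iN : (i <= n + k + j)%N by move: ii => /andP[_];
    lia.
  by rewrite (dvdn_subl iN ki) kN knj.
move: kN; rewrite knj => /dvdnP[L NL].
set m := ((j + (k - 1)) %/ k)%N.
have mP t : (j <= k * t)%N = (m <= t)%N.
  by rewrite -[in RHS]ltnS ltn_divLR// mulSn [(t * k)%N]mulnC; lia.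
have m0 : (0 < m)%N by rewrite divn_gt0//; lia.
have -> : ((n %/ k).+2 - m = L.+1 - m.*2)%N.
  have L0 : (0 < L)%N by case: L NL => //; lia.
  have mL : (m <= L - 1)%N by rewrite -mP mulnBr muln1 [(k * L)%N]mulnC -NL; lia.
  have jm : (j <= k * m)%N by rewrite mP.
  have mj : (k * (m - 1) < j)%N by rewrite ltnNge mP; lia.
  have nE : n = ((L - 1 - m) * k + (k * m - j))%N.
    rewrite !mulnBl mul1n -NL [(m * k)%N]mulnC.
    have : (k * m <= k * (L - 1))%N by rewrite leq_pmul2l.
    rewrite mulnBr muln1 [(k * L)%N]mulnC -NL; lia.
  have -> : (n %/ k)%N = (L - 1 - m)%N.
    rewrite {1}nE divnMDl// divn_small ?addn0//.
    by move: mj; rewrite mulnBr muln1; lia.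
  lia.
rewrite -sum_interval// -(sum_multiples (fun t =>
  ((m <= t) && (m <= L - t))%N%:R) L k0) NL [(L * k)%N]mulnC; apply: eq_big_nat => i iL.
case: ifP => // /dvdnP[t it]; rewrite it mulnK// mulnC.
have tL : (t <= L)%N by rewrite -(leq_pmul2l k0) mulnC -it; lia.
by rewrite -mulnBl dvdn_mull//= [(t * k)%N]mulnC [((L - t) * k)%N]mulnC !mP.
Qed.


(** Since j > 0, the overlap avoids the exceptional entries -d of both vectors, at i = 0 and at i =
    n + k + j. Only ones meet, and the inner product is a count up to the scale. *)
Lemma normc2_inner_phi_psi n j : (0 < j)%N ->
  normc2 (inner (coefs_of_poly (wvar R ^+ j * phi gen n))
                (coefs_of_poly (zvar R ^+ j * psi gen n))) =
  if (k %| n + j)%N then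
    (((n %/ k).+2 - (j + (k - 1)) %/ k)%N%:R / ((n %/ k).+1%:R * (n %/ k).+2%:R)) ^+ 2
      else 0.
Proof.
move=> j0; rewrite (@inner_antidiag _ _ _ (n + k + j)%N); last first.
  move=> [a b] /= abn; rewrite coefs_of_poly_zX; case: ltnP => // ja.
  rewrite coefs_psi// /phi_shape /=; have -> : (b + (a - j) == n + k)%N = false by lia.
  by rewrite mulr0 oppr0.
transitivity (normc2 (- (phi_scale R k n * (phi_scale R k n)^*) *
  (\sum_(0 <= i < (n + k + j).+1) (((k %| i) && (k %| n + k + j - i)) &&
    ((j <= i) && (j <= n + k + j - i)))%N%:R)%:C%C)).
  congr normc2; rewrite big_mkord rmorph_sum mulr_sumr; apply: eq_bigr => i _.
  have iN := ltn_ord i.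
  rewrite coefs_of_poly_wX coefs_of_poly_zX.
  case: (ltnP (n + k + j - i) j) => ji; first by rewrite !andbF mul0r rmorph0 mulr0.
  case: (ltnP i j) => ji'; first by rewrite andbF !rmorph0 !mulr0.
  rewrite coefs_phi// coefs_psi// !andbT rmorph_nat /phi_shape /=.
  have -> : (i + (n + k + j - i - j) == n + k)%N by lia.
  have -> : (n + k + j - i + (i - j) == n + k)%N by lia.
  have -> : (i == 0 :> nat) = false by lia.
  have -> : (n + k + j - i == 0)%N = false by lia.
  rewrite /=; case: (k %| i)%N; case: (k %| _)%N;
    rewrite /= ?mulr0 ?mul0r ?oppr0 ?rmorph0 ?mulr0//.
  by rewrite !mulr1 rmorphN mulrN.
rewrite sum_phi_shape_overlap// normc2M normc2N normc2M normc2_conj normc2_phi_scale//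
  normc2C.
case: ifP => _; last by rewrite expr0n mulr0.
by rewrite [RHS]exprMn mulrC -expr2.
Qed.

Lemma Sigma_highE j : (2 <= j)%N -> Sigma j gen =
  (\sum_(0 <= d <oo) (((d.+2 - (j + (k - 1)) %/ k)%N%:R / (d.+1%:R * d.+2%:R)) ^+ 2)%:E)%E.
Proof.
case: j => [|[|j]]// _; rewrite /Sigma; set J := j.+2.
set m := ((J + (k - 1)) %/ k)%N.
rewrite nneseries_esumT; last by move=> n; rewrite lee_fin sqr_ge0.
rewrite [RHS]nneseries_esumT; last by move=> n; rewrite lee_fin sqr_ge0.
under eq_esum do rewrite -/(normc2 _) normc2_inner_phi_psi//.
have Jm : (J <= k * m)%N by rewrite /m; have := divn_eq (J + (k - 1)) k;
  have := ltn_pmod (J + (k - 1)) k0; rewrite mulnC; lia.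
have mJ : (k * m - J < k)%N by have := leq_divM (J + (k - 1)) k; rewrite -/m mulnC; lia.
(* The n with k dividing n + j are n = k d + (k m - j), and floor(n/k) = d because k m - j < k. *)
rewrite (@esum_support_image _ _ _ (fun d => (k * d + (k * m - J))%N)); last 2 first.
- by move=> d d' /eqP; rewrite eqn_add2r eqn_pmul2l// => /eqP.
- move=> n H; case: ifP => // kn; exfalso; apply: (H (n %/ k)%N).
  suff -> : (k * m - J)%N = (n %% k)%N by rewrite mulnC -divn_eq.
  have := kn; rewrite {1}(divn_eq n k) -addnA dvdn_addr ?dvdn_mull//.
  move=> /dvdnP[q nq]; have nk := ltn_pmod n k0.
  have q1 : (q < m.+1)%N.
    rewrite -(ltn_pmul2r k0) -nq mulSn [(m * k)%N]mulnC; lia.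
  have q2 : (m < q.+1)%N.
    by rewrite -(ltn_pmul2r k0) mulSn -nq [(m * k)%N]mulnC; lia.
  have qm : q = m by lia.
  by move: nq; rewrite qm mulnC; lia.
apply: eq_esum => d _ /=.
have -> : (k %| k * d + (k * m - J) + J)%N by rewrite -addnA subnK// -mulnDr dvdn_mulr.
by rewrite mulnC divnMDl// (divn_small mJ) addn0.
Qed.

End SigmaSeries.

(** * The series of inverse squares *)

Section Basel.
Variable R : realType.
Implicit Types x : R.

Lemma sin_le_id x : 0 <= x -> sin x <= x.
Proof.
rewrite le_eqVlt => /orP[/eqP <-|x0]; first by rewrite sin0.
have [c _] : exists2 c, c \in `]0, x[ & sin x - sin 0 = cos c * (x - 0).
  by apply: MVT => //; apply: continuous_subspaceT => y; exact: continuous_sin.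
rewrite sin0 !subr0 => ->; rewrite ler_piMl ?(ltW x0)//; exact: cos_le1.
Qed.

Lemma mul_cos_le_sin x : 0 < x < pi / 2 -> x * cos x <= sin x.
Proof.
move=> /andP[x0 xpi].
have cosy y : y \in `[0, x] -> cos y != 0.
  rewrite in_itv /= => /andP[y0 yx]; apply: lt0r_neq0; apply: cos_gt0_pihalf.
  by rewrite (lt_le_trans _ y0) ?oppr_lt0 ?divr_gt0 ?pi_gt0//= (le_lt_trans yx).
have [c cx] : exists2 c, c \in `]0, x[ & tan x - tan 0 = cos c ^- 2 * (x - 0).
  apply: (@MVT _ _ (fun y => cos y ^- 2)) => // [y yx|].
    apply: is_derive_tan; apply: cosy.
    by move: yx; rewrite !in_itv /= => /andP[/ltW -> /ltW ->].
  by apply: derivable_within_continuous => y yx; apply: derivable_tan; exact: cosy.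
rewrite tan0 !subr0 /tan => E.
have cx0 : 0 < cos x.
  by apply: cos_gt0_pihalf; rewrite (lt_trans _ x0) ?oppr_lt0 ?divr_gt0 ?pi_gt0.
rewrite -ler_pdivlMr// E ler_peMl ?(ltW x0)// -[leLHS]invr1.
have cc0 : cos c != 0.
  by apply: cosy; move: cx; rewrite !in_itv /= => /andP[/ltW -> /ltW ->].
have c2 : 0 < cos c ^+ 2 by rewrite lt_def sqr_ge0 sqrf_eq0 cc0.
by rewrite lef_pV2 ?posrE ?ltr01// -cos2Dsin2 lerDl sqr_ge0.
Qed.

(** This is sin x <= x <= tan x, as the left-hand side is cot^2 x. *)
Lemma inv_sqr_bounds x : 0 < x < pi / 2 ->
  sin x ^- 2 - 1 <= x ^- 2 <= sin x ^- 2.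
Proof.
move=> xpi; have /andP[x0 _] := xpi.
have s0 := sin_gt0_pihalf xpi.
have sx := sin_le_id (ltW x0).
have cs := mul_cos_le_sin xpi.
have cx0 : 0 < cos x.
  apply: cos_gt0_pihalf; move/andP: xpi => [_ ->].
  by rewrite (lt_trans _ x0) ?oppr_lt0 ?divr_gt0 ?pi_gt0.
apply/andP; split; last first.
  by rewrite lef_pV2 ?posrE ?exprn_gt0// ler_pXn2r// nnegrE ltW.
have -> : sin x ^- 2 - 1 = (cos x / sin x) ^+ 2.
  by rewrite expr_div_n cos2sin2; field; rewrite gt_eqF.
rewrite -exprVn ler_pXn2r//; last 2 first.
- by rewrite nnegrE ltW// divr_gt0.
- by rewrite nnegrE ltW// invr_gt0.
by rewrite ler_pdivrMr// mulrC ler_pdivlMr// mulrC.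
Qed.

Lemma inv_sin_sqrD x : 0 < x < pi / 2 ->
  sin x ^- 2 + sin (pi / 2 - x) ^- 2 = 4 * sin (x *+ 2) ^- 2.
Proof.
move=> xpi; have s0 := sin_gt0_pihalf xpi.
have c0 : 0 < cos x.
  apply: cos_gt0_pihalf; move/andP: xpi => [x0 ->].
  by rewrite (lt_trans _ x0) ?oppr_lt0 ?divr_gt0 ?pi_gt0.
rewrite sinB sin_pihalf cos_pihalf mul1r mul0r subr0 sin_mulr2n mulr2n.
rewrite -[RHS]mul1r -[X in X * _](cos2Dsin2 x); field.
by rewrite !gt_eqF//= addr_gt0// mulr_gt0.
Qed.

Lemma sum_fold (F : nat -> R) m : (0 < m)%N ->
  \sum_(1 <= i < m.*2) F i = \sum_(1 <= i < m) (F i + F (m.*2 - i)%N) + F m.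
Proof.
move=> m0; rewrite (@big_cat_nat _ _ _ m)//=; last by lia.
rewrite [X in _ + X]big_ltn; last by lia.
rewrite big_split /= -addrA; congr (_ + _); rewrite addrC; congr (_ + _).
rewrite big_nat_rev /= -{1}[m.+1]addn1 addnC big_addn.
rewrite (_ : (m.*2 - m)%N = m); last by lia.
by apply: eq_big_nat => i im; congr F; lia.
Qed.

(** These points cut (0, pi/2) into 2^n equal parts; doubling a point of level n + 1 gives the point
    of level n with the same index. *)
Definition angle (n i : nat) : R := i%:R * pi / 2 ^+ n.+1.

Definition sin_sum (n : nat) : R := \sum_(1 <= i < 2 ^ n) sin (angle n i) ^- 2.

Lemma angle_bounds n i : (1 <= i < 2 ^ n)%N -> 0 < angle n i < pi / 2.
Proof.
move=> /andP[i1 i2]; rewrite /angle divr_gt0 ?mulr_gt0 ?pi_gt0 ?ltr0n ?exprn_gt0//=.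
rewrite ltr_pdivrMr ?exprn_gt0// exprS mulrA divfK// mulrC ltr_pM2l ?pi_gt0//.
by rewrite -natrX ltr_nat.
Qed.

(** Fold about pi/4: x and pi/2 - x together give 4 / sin^2(2x), a term of level n, and the middle
    angle pi/4 gives 2. *)
Lemma sin_sum_rec n : sin_sum n.+1 = 4 * sin_sum n + 2.
Proof.
have m0 : (0 < 2 ^ n)%N by rewrite expn_gt0.
rewrite /sin_sum expnS mul2n sum_fold//; congr (_ + _); last first.
  have -> : angle n.+1 (2 ^ n) = pi / 4.
    rewrite /angle natrX !exprS; field.
    by rewrite expf_neq0.
  have := cos_mulr2n (pi / 4 : R).
  rewrite (_ : pi / 4 *+ 2 = pi / 2 :> R); last by rewrite mulr2n; field.
  rewrite cos_pihalf cos2sin2 mulr2n => E.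
  have -> : sin (pi / 4 : R) ^+ 2 = 1 / 2 by lra.
  by rewrite div1r invrK.
rewrite mulr_sumr; apply: eq_big_nat => i im.
have im' : (1 <= i < 2 ^ n.+1)%N by rewrite expnS; lia.
have -> : angle n.+1 ((2 ^ n).*2 - i) = pi / 2 - angle n.+1 i.
  rewrite /angle natrB; last by lia.
  rewrite -mul2n natrM natrX !exprS; field.
  by rewrite expf_neq0.
rewrite inv_sin_sqrD ?angle_bounds//; congr (_ * sin _ ^- 2).
rewrite /angle mulr2n !exprS; field.
by rewrite expf_neq0.
Qed.

Lemma sin_sumE n : sin_sum n = 2 * (4 ^+ n - 1) / 3.
Proof.
elim: n => [|n IH]; first by rewrite /sin_sum expn0 big_geq// expr0 subrr mulr0 mul0r.
by rewrite sin_sum_rec IH exprS; field.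
Qed.

(** After scaling by (pi / 2^(n+1))^2 the upper estimate is (1 - 4^(-n)) pi^2/6 and the lower one
    subtracts pi^2 / 2^(n+2) more; the error pi^2 / 2^n covers both. *)
Lemma sum_inv_sqr_bounds n :
  pi ^+ 2 / 6 - pi ^+ 2 / 2 ^+ n <= \sum_(1 <= i < 2 ^ n) (i%:R ^- 2 : R) <= pi ^+ 2 / 6.
Proof.
have E : \sum_(1 <= i < 2 ^ n) i%:R ^- 2 =
    (pi / 2 ^+ n.+1) ^+ 2 * \sum_(1 <= i < 2 ^ n) angle n i ^- 2 :> R.
  rewrite mulr_sumr; apply: eq_big_nat => i /andP[i1 _]; rewrite /angle.
  have i0 : i%:R != 0 :> R by rewrite pnatr_eq0 -lt0n.
  have x0 : 2 ^+ n.+1 != 0 :> R by rewrite expf_neq0.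
  have p0 : (pi : R) != 0 by rewrite gt_eqF// pi_gt0.
  by move: (2 ^+ n.+1 : R) (pi : R) x0 p0 => x p x0 p0; field; rewrite x0 i0 p0.
have U : \sum_(1 <= i < 2 ^ n) angle n i ^- 2 <= sin_sum n.
  by apply: ler_sum_nat => i im; have /andP[] := inv_sqr_bounds (angle_bounds im).
have L : sin_sum n - 2 ^+ n <= \sum_(1 <= i < 2 ^ n) angle n i ^- 2.
  apply: (@le_trans _ _ (\sum_(1 <= i < 2 ^ n) (sin (angle n i) ^- 2 - 1))); last first.
    by apply: ler_sum_nat => i im; have /andP[] := inv_sqr_bounds (angle_bounds im).
  rewrite sumrB lerB// sumr_const_nat -natrX ler_nat; lia.
rewrite E; move: U L; rewrite sin_sumE.
have -> : 4 ^+ n = (2 ^+ n) ^+ 2 :> R by rewrite -exprM mulnC exprM; congr (_ ^+ n); ring.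
rewrite (exprS (2 : R) n); have : 1 <= 2 ^+ n :> R by rewrite exprn_ege1// ler1n.
have p0 : 0 <= pi ^+ 2 :> R by rewrite sqr_ge0.
move: (2 ^+ n) (\sum_(_ <= _ < _) _) => x T x1 U L.
have xx0 : 0 < x by lra.
rewrite (_ : (pi / (2 * x)) ^+ 2 * T = pi ^+ 2 * (T / (4 * x ^+ 2))); last by field; lra.
rewrite (_ : pi ^+ 2 / 6 - pi ^+ 2 / x = pi ^+ 2 * (1 / 6 - 1 / x)); last by field; lra.
rewrite (_ : pi ^+ 2 / 6 = pi ^+ 2 * (1 / 6)); last by field.
have x20 : 0 < 4 * x ^+ 2 by rewrite mulr_gt0// exprn_gt0.
rewrite !ler_wpM2l// ?ler_pdivrMr ?ler_pdivlMr//.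
  by rewrite (_ : 1 / 6 * (4 * x ^+ 2) = 2 * x ^+ 2 / 3) //; [lra|field].
by rewrite (_ : (1 / 6 - 1 / x) * (4 * x ^+ 2) = 2 * x ^+ 2 / 3 - 4 * x) //;
  [lra|field; lra].
Qed.

Lemma basel_series : (\sum_(0 <= n <oo) (n%:R^-1 ^+ 2 : R)%:E)%E = (pi ^+ 2 / 6)%:E.
Proof.
have T n : \sum_(0 <= i < 2 ^ n) (i%:R^-1 ^+ 2 : R) = \sum_(1 <= i < 2 ^ n) i%:R ^- 2.
  rewrite big_ltn ?expn_gt0// invr0 expr0n add0r.
  by apply: eq_bigr => i _; rewrite exprVn.
apply/eqP; rewrite eq_le; apply/andP; split.
  apply: lime_le; first by apply: is_cvg_nneseries => n _ _; rewrite lee_fin sqr_ge0.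
  apply: nearW => n; rewrite sumEFin lee_fin.
  have /andP[_ ] := sum_inv_sqr_bounds n; apply: le_trans; rewrite -T.
  rewrite [leRHS](@big_cat_nat _ _ _ n)//=; last exact/ltnW/ltn_expl.
  by rewrite lerDl sumr_ge0// => i _; exact: sqr_ge0.
apply/lee_addgt0Pr => e e0.
have [n ne] : exists n, pi ^+ 2 / 2 ^+ n <= e.
  have y0 : 0 <= pi ^+ 2 / e by rewrite divr_ge0 ?sqr_ge0 ?ltW.
  exists (Num.bound (pi ^+ 2 / e)).
  rewrite ler_pdivrMr ?exprn_gt0// mulrC -ler_pdivrMr//.
  apply: le_trans (ltW (archi_boundP y0)) _.
  by rewrite -natrX ler_nat ltnW// ltn_expl.
apply: (@le_trans _ _ ((\sum_(0 <= i < 2 ^ n) (i%:R^-1 ^+ 2 : R))%:E + e%:E)%E).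
  rewrite -EFinD lee_fin T; have /andP[+ _] := sum_inv_sqr_bounds n; lra.
rewrite leeD2r// -sumEFin; apply: nneseries_lim_ge => i _ _.
by rewrite lee_fin sqr_ge0.
Qed.
End Basel.

(** The commutator formula joins the others at j = 1: there m = 1, and the term (d + 1)/((d + 1)(d +
    2)) is 1/(d + 2). *)
Lemma Sigma_seriesE (R : realType) k j : (0 < k)%N -> (1 <= j)%N ->
  Sigma j (zvar R ^+ k - wvar R ^+ k) =
  (\sum_(0 <= d <oo)
    (((d.+2 - (j + (k - 1)) %/ k)%N%:R / (d.+1%:R * d.+2%:R)) ^+ 2 : R)%:E)%E.
Proof.
move=> k0; case: j => [//|[|j]] _; last exact: Sigma_highE.
rewrite Sigma1E// add1n subn1 prednK// divnn k0; apply: eq_eseriesr => d _.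
by rewrite subn1 invfM mulrA mulfV ?mul1r// pnatr_eq0.
Qed.

Lemma absz_ceil_divn (R : realType) j k : (0 < k)%N ->
  `|Num.ceil (j%:R / k%:R : R)|%N = ((j + (k - 1)) %/ k)%N.
Proof.
move=> k0; set m := (_ %/ k)%N.
have kR : 0 < k%:R :> R by rewrite ltr0n.
have E := divn_eq (j + (k - 1)) k; have L := ltn_pmod (j + (k - 1)) k0.
rewrite (@ceil_def _ _ m%:Z)//; apply/andP; split.
  rewrite intrB ltr_pdivlMr// -pmulrn mulrBl mul1r ltrBlDr -natrM -natrD ltr_nat.
  by rewrite -/m in E; lia.
by rewrite ler_pdivrMr// -pmulrn -natrM ler_nat; rewrite -/m in E; lia.
Qed.

Theorem theorem1p1 (R : realType) (k : nat) (hk : (2 <= k)%N) :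
  Sigma 0 (zvar R ^+ k - wvar R ^+ k) = (pi ^+ 2 / 6)%:E /\
  forall j : nat, (1 <= j)%N ->
    Sigma j (zvar R ^+ k - wvar R ^+ k) =
    Sigma `|Num.ceil (j%:R / k%:R : R)|%N (zvar R - wvar R).
Proof.
have k0 : (0 < k)%N by exact: ltnW.
split; first by rewrite Sigma0E// basel_series.
(* z - w is the case k = 1, where the ceiling of m/1 is m, so both sides are the same series. *)
move=> j j1; rewrite absz_ceil_divn// -(expr1 (zvar R)) -(expr1 (wvar R)).
rewrite !Sigma_seriesE ?subnn ?addn0 ?divn1//; last by rewrite divn_gt0//; lia.
Qed.
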